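(* There is an absolute constant $C$ such that the following holds. Let $(X,\Pi)$ be a $d$-dimensional $\gamma$-non-lazy $(\delta,\gamma)$-eposet, $M$ a monotonic HD-walk on $C_k$ ($k<d$), and suppose $\gamma$ is small enough that there are $c_0,\dots,c_k\ge0$ with $\|Mf-\lambda_j(M)f\|\le c_j\|f\|$ for all $f\in V^j_k$ and $c_j+c_{j+1}<\lambda_j(M)-\lambda_{j+1}(M)$ for all $j<k$ (so the intervals $J_j=[\lambda_j(M)-c_j,\lambda_j(M)+c_j]$ are disjoint). For $\eta>0$ let $r=R_\eta(M)-1$. Let $S\subseteq X(k)$ have density $\alpha=\pi_k(S)$ and suppose $\mathbb 1_S$ is $(\varepsilon_1,\dots,\varepsilon_r)$-pseudorandom (in either the $\ell_2$ or the $\ell_\infty$ sense). Then \[\Phi(S)\ge1-\alpha-(1-\alpha)\eta-\sum_{i=1}^r(\lambda_i(M)-\eta)R(k,i)\varepsilon_i-c\gamma,\] where $c\le C\frac{k^5R_{\max}^2(h(M)+k)h(M)w(M)}{\max_i\{\delta_i(1-\delta_{i-1})\}}$.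
   Context: A $d$-dimensional graded poset is a poset $(X,<)$ with a rank function partitioning $X=X(0)\cup\dots\cup X(d)$, ranks increasing along $<$ and covers raising rank by one; $y\lessdot x$ means $y<x$ with rank$(x)=$rank$(y)+1$. Standing assumptions: $|X(0)|=1$, all maximal elements have rank $d$, and $X$ is regular: every $x\in X(k)$ is greater than exactly $R(k,i)$ elements of $X(i)$, and the number of maximal chains between comparable $x_k\in X(k)$, $x_i\in X(i)$ depends only on $k,i$. A probability distribution $\pi_d$ on $X(d)$ induces $\pi_i(x)=\frac{1}{R(i+1,i)}\sum_{y\gtrdot x}\pi_{i+1}(y)$. $C_k$ = real functions on $X(k)$, $\langle f,g\rangle=\sum_\tau\pi_k(\tau)f(\tau)g(\tau)$, $\|f\|=\langle f,f\rangle^{1/2}$, $\mathbb E[f]=\sum_\tau\pi_k(\tau)f(\tau)$; for $g\in C_i$, $\mathrm{Var}(g)=\langle g,g\rangle-\mathbb E[g]^2$ w.r.t. $\pi_i$. $U_if(y)=\frac{1}{R(i+1,i)}\sum_{x\lessdot y}f(x)$, $D_{i+1}f(x)=\frac{\sum_{y\gtrdot x}\pi_{i+1}(y)f(y)}{\sum_{y\gtrdot x}\pi_{i+1}(y)}$, $U^k_i=U_{k-1}\cdots U_i$, $D^k_i=D_{i+1}\cdots D_k$. $(X,\Pi)$ is a $(\delta,\gamma)$-eposet ($\delta\in[0,1]^{d-1}$, $\gamma<1$) if $\|D_{i+1}U_i-(1-\delta_i)I-\delta_iU_{i-1}D_i\|\le\gamma$ for $1\le i\le d-1$; $\gamma$-non-lazy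 if for every $1\le i\le d$ and $\sigma\in X(i)$ the walk $U_{i-1}D_i$ returns from $\sigma$ to $\sigma$ with probability at most $\gamma$. HD-Level-Set Decomposition: $H^0=C_0$, $H^i=\ker D_i$, $V^i_k=U^k_iH^i$ (for small $\gamma$, $C_k=\bigoplus_iV^i_k$). Notation: $\delta^m_t=\prod_{r=m-t}^m\delta_r$ ($t\ge0$), $\delta^m_t=1$ ($t<0$); $R_{\max}=\max_{0\le i\le k}R(k,i)$. A pure walk $Y$ of height $h$ on $C_k$ is $Z_{2h}\circ\cdots\circ Z_1$ ($Z_1$ applied first) with $h$ up and $h$ down operators; with down operators at positions $i_1<\dots<i_h$, $\lambda_{Y,\delta,\ell}=\prod_{s=1}^h(1-\delta^{k-2s+i_s}_{k-2s+i_s-\ell})$. An HD-walk is an affine combination $M=\sum\alpha_YY$ ($\sum\alpha_Y=1$) of pure walks on $C_k$ that is stochastic and self-adjoint; $h(M)$ = max height of $Y$ with $\alpha_Y\ne0$, $w(M)=\sum|\alpha_Y|$, $\lambda_\ell(M)=\sum\alpha_Y\lambda_{Y,\delta,\ell}$; $M$ is monotonic if $\lambda_0(M)\ge\dots\ge\lambda_k(M)$. The stripped threshold rank $R_\eta(M)$ is the number of indices $j$ such that the interval $J_j$ contains an eigenvalue of $M$ greater than $\eta$. Edge expansion: $\Phi(S)=\mathbb E_{v\sim\pi_k|_S}\big[\sum_{y\notin S}M(v,y)\big]$ with $M(v,y)$ the transition probabilities of $M$ and $\pi_k|_S$ the conditional distribution. $\mathbb 1_S$ is $(\varepsilon_1,\dots,\varepsilon_r)$-$\ell_2$-pseudorandom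 if $\mathrm{Var}(D^k_i\mathbb 1_S)\le\varepsilon_i\mathbb E[\mathbb 1_S]$ for $1\le i\le r$, and $\ell_\infty$-pseudorandom if $\|D^k_i\mathbb 1_S-\mathbb E[\mathbb 1_S]\|_\infty\le\varepsilon_i$ for $1\le i\le r$.
   Formalization: The formal theorem adds the assumption ε_i ≤ 1 for those 1≤i≤r with λ_i(M)<η; otherwise the summand −(λ_i−η)R(k,i)ε_i is positive and letting ε_i grow makes the inequality false (e.g. K_5, k=1, M=D_2U_1, η=1/4). *)

(* Defs.v *)
From HB Require Import structures.
From mathcomp Require Import all_boot all_order all_algebra.
From mathcomp Require Import finmap.
From mathcomp Require Import boolp reals.

Set Implicit Arguments.
Unset Strict Implicit.
Unset Printing Implicit Defensive.

Import Order.TTheory GRing.Theory Num.Theory.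

Local Open Scope ring_scope.

Section Chains.
Variables (disp : Order.disp_t) (X : finPOrderType disp).

Definition covers (x y : X) : bool :=
  (x < y)%O && ~~ [exists z, (x < z)%O && (z < y)%O].

Definition chain_between (x y : X) (c : {set X}) : bool :=
  (c \subset [set z | (x <= z)%O && (z <= y)%O]) &&
  [forall a in c, forall b in c, (a >=< b)%O].

Definition nmaxchains (x y : X) : nat :=
  #|[set c : {set X} | maxset (chain_between x y) c]|.

End Chains.

(* [reg k i] is R(k,i).  It counts the elements of rank i that are below x in
   the large order, so that R(k,k) = 1; for i < k this is the number of
   elements of rank i strictly below x. *)
Record measured_poset (R : realType) := MeasuredPoset {
  mp_disp : Order.disp_t;
  mp_carrier :> finPOrderType mp_disp;
  poset_dim : nat;
  rk : mp_carrier -> nat;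
  reg : nat -> nat -> nat;
  top_distr : mp_carrier -> R;
  rk_le_dim : forall x, (rk x <= poset_dim)%N;
  rk_lt : forall x y : mp_carrier, (x < y)%O -> (rk x < rk y)%N;
  rk_covers : forall x y : mp_carrier, covers x y -> rk y = (rk x).+1;
  card_rk0 : #|[set x | rk x == 0%N]| = 1%N;
  rk_maximal : forall x : mp_carrier,
    (forall y : mp_carrier, ~~ (x < y)%O) -> rk x = poset_dim;
  regP : forall (k i : nat) (x : mp_carrier), (i <= k)%N -> rk x = k ->
    #|[set y : mp_carrier | (rk y == i) && (y <= x)%O]| = reg k i;
  maxchains_regular : exists m : nat -> nat -> nat,
    forall x y : mp_carrier, (x < y)%O -> nmaxchains x y = m (rk y) (rk x);
  top_distr_ge0 : forall x, rk x = poset_dim -> 0 <= top_distr x;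
  top_distr_sum : \sum_(x | rk x == poset_dim) top_distr x = 1
}.

Arguments poset_dim {R} m.
Arguments rk {R} {m} x.
Arguments reg {R} m k i.
Arguments top_distr {R} m x.

(* A function on X(k) is represented by the function on the whole poset that
   extends it by 0 (predicate [cochain k]).  With this encoding the operators
   U_i : C_i -> C_(i+1), for all i, are the restrictions of the single operator
   [up_op] to the subspaces C_i, and the D_(i+1) : C_(i+1) -> C_i are the
   restrictions of [down_op]. *)
Section Cochains.
Variables (R : realType) (P : measured_poset R).
Implicit Types (f g : {ffun P -> R}) (x y : P).

(* x is covered by y, in the sense of ranks *)
Definition below x y : bool := (x < y)%O && (rk y == (rk x).+1).

Fixpoint pi_codim (n : nat) (x : P) : R :=
  if n is n'.+1 then
    (reg P (rk x).+1 (rk x))%:R^-1 * \sum_(y | below x y) pi_codim n' y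
  else top_distr P x.

(* pi_i(x), for i = rk x *)
Definition piw x : R := pi_codim (poset_dim P - rk x) x.

Definition cochain (k : nat) f : Prop := forall x, rk x != k -> f x = 0.

Definition inner (k : nat) f g : R := \sum_(x | rk x == k) piw x * f x * g x.

Definition cnorm (k : nat) f : R := Num.sqrt (inner k f f).

Definition expect (k : nat) f : R := \sum_(x | rk x == k) piw x * f x.

Definition variance (k : nat) f : R := inner k f f - expect k f ^+ 2.

Definition up_op f : {ffun P -> R} :=
  [ffun y => (reg P (rk y) (rk y).-1)%:R^-1 * \sum_(x | below x y) f x].

Definition down_op f : {ffun P -> R} :=
  [ffun x => (\sum_(y | below x y) piw y * f y) / \sum_(y | below x y) piw y].

(* The denominators in the formula for D_(i+1), 0 <= i < d, do not vanish. *)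
Definition D_well_defined : Prop :=
  forall x, (rk x < poset_dim P)%N -> 0 < \sum_(y | below x y) piw y.

(* U^k_i : C_i -> C_k and D^k_i : C_k -> C_i *)
Definition up_ki (k i : nat) f : {ffun P -> R} := iter (k - i) up_op f.
Definition down_ki (k i : nat) f : {ffun P -> R} := iter (k - i) down_op f.

Definition indic (S : {set P}) : {ffun P -> R} := [ffun x => (x \in S)%:R].

(* Transition probability from v to y of the walk on X(k) whose averaging
   operator is T. *)
Definition transition (T : {ffun P -> R} -> {ffun P -> R}) (v y : P) : R :=
  T (indic [set y]) v.

Definition non_lazy (gamma : R) : Prop :=
  forall x, (0 < rk x)%N -> transition (up_op \o down_op) x x <= gamma.

(* The parameters delta_1, ..., delta_(d-1) are completed by delta_0 = 0:
   D_1 U_0 is the identity of the one-dimensional space C_0. *)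
Definition eposet (delta : nat -> R) (gamma : R) : Prop :=
  [/\ delta 0%N = 0,
      forall i, (1 <= i < poset_dim P)%N -> 0 <= delta i <= 1,
      gamma < 1 &
      forall i, (1 <= i < poset_dim P)%N -> forall f, cochain i f ->
        cnorm i [ffun x => down_op (up_op f) x - (1 - delta i) * f x
                          - delta i * up_op (down_op f) x]
        <= gamma * cnorm i f].

Definition H_space (i : nat) f : Prop := cochain i f /\ ((0 < i)%N -> down_op f = 0).

Definition V_space (k i : nat) f : Prop := exists2 g, H_space i g & f = up_ki k i g.

(* Pure walks are words Z_1, ..., Z_2h (Z_1, the operator applied first, is the
   head of the sequence) where [true] stands for U and [false] for D. *)
Fixpoint stays_in_poset (j : nat) (Y : seq bool) : bool :=
  match Y with
  | [::] => true
  | true :: Y' => (j < poset_dim P)%N && stays_in_poset j.+1 Y'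
  | false :: Y' => (0 < j)%N && stays_in_poset j.-1 Y'
  end.

Definition pure_walk (k : nat) (Y : seq bool) : bool :=
  (count_mem true Y == count_mem false Y) && stays_in_poset k Y.

Definition walk_op (Y : seq bool) f : {ffun P -> R} :=
  foldl (fun g (b : bool) => if b then up_op g else down_op g) f Y.

Definition height (Y : seq bool) : nat := count_mem false Y.

(* The increasing sequence i_1 < ... < i_h of the positions of the down
   operators, positions being counted from 1. *)
Definition down_positions (Y : seq bool) : seq nat :=
  [seq p <- iota 1 (size Y) | ~~ nth true Y p.-1].

(* delta^m_t *)
Definition delta_prod (delta : nat -> R) (m : nat) (t : int) : R :=
  match t with
  | Posz n => \prod_(m - n <= q < m.+1) delta q
  | Negz _ => 1
  end.

(* lambda_(Y,delta,l).  On a pure walk the truncated subtraction is exact: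
   k + i_s - 2 s is the rank reached by the s-th down operator. *)
Definition lambda_walk (delta : nat -> R) (k l : nat) (Y : seq bool) : R :=
  \prod_(1 <= s < (height Y).+1)
    let m := (k + nth 0 (down_positions Y) s.-1 - 2 * s)%N in
    1 - delta_prod delta m (m%:Z - l%:Z).

(* An affine combination of pure walks is given by its finitely supported
   family of coefficients. *)
Implicit Type alpha : {fsfun seq bool -> R with 0}.

Definition hd_op alpha f : {ffun P -> R} :=
  [ffun x => \sum_(Y <- finsupp alpha) alpha Y * walk_op Y f x].

Definition stochastic (k : nat) (T : {ffun P -> R} -> {ffun P -> R}) : Prop :=
  forall v, rk v = k ->
    (forall y, rk y = k -> 0 <= transition T v y) /\
    \sum_(y | rk y == k) transition T v y = 1.

Definition self_adjoint (k : nat) (T : {ffun P -> R} -> {ffun P -> R}) : Prop :=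
  forall f g, cochain k f -> cochain k g -> inner k (T f) g = inner k f (T g).

Definition hd_walk (k : nat) alpha : Prop :=
  [/\ forall Y, Y \in finsupp alpha -> pure_walk k Y,
      \sum_(Y <- finsupp alpha) alpha Y = 1,
      stochastic k (hd_op alpha) & self_adjoint k (hd_op alpha)].

Definition hd_height alpha : nat := \max_(Y <- finsupp alpha) height Y.

Definition hd_weight alpha : R := \sum_(Y <- finsupp alpha) `|alpha Y|.

Definition hd_lambda (delta : nat -> R) (k l : nat) alpha : R :=
  \sum_(Y <- finsupp alpha) alpha Y * lambda_walk delta k l Y.

Definition monotonic (delta : nat -> R) (k : nat) alpha : Prop :=
  forall j, (j < k)%N -> hd_lambda delta k j.+1 alpha <= hd_lambda delta k j alpha.

Definition eigenvalue_on (k : nat) (T : {ffun P -> R} -> {ffun P -> R}) (mu : R)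
    : Prop :=
  exists f, [/\ cochain k f, f != 0 & T f = [ffun x => mu * f x]].

(* R_eta(M), relative to the intervals J_j = [lambda_j - c_j, lambda_j + c_j] *)
Definition stripped_threshold_rank (delta : nat -> R) (k : nat) alpha
    (c : nat -> R) (eta : R) : nat :=
  #|[set j : 'I_k.+1 | `[< exists mu,
       [/\ eigenvalue_on k (hd_op alpha) mu, eta < mu &
           mu \in `[hd_lambda delta k j alpha - c j,
                    hd_lambda delta k j alpha + c j]] >]]|.

Definition density (S : {set P}) : R := \sum_(x in S) piw x.

Definition expansion (k : nat) (T : {ffun P -> R} -> {ffun P -> R})
    (S : {set P}) : R :=
  \sum_(v in S) piw v / density S *
    \sum_(y | (rk y == k) && (y \notin S)) transition T v y.

Definition l2_pseudorandom (k r : nat) (eps : nat -> R) f : Prop :=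
  forall i, (1 <= i <= r)%N -> variance i (down_ki k i f) <= eps i * expect k f.

Definition linf_pseudorandom (k r : nat) (eps : nat -> R) f : Prop :=
  forall i, (1 <= i <= r)%N ->
    forall x, rk x = i -> `|down_ki k i f x - expect k f| <= eps i.

Definition reg_max (k : nat) : nat := \max_(i < k.+1) reg P k i.

Definition max_delta (delta : nat -> R) : R :=
  \big[Num.max/0]_(1 <= i < poset_dim P) (delta i * (1 - delta i.-1)).

End Cochains.

Arguments D_well_defined {R} P.
Arguments non_lazy {R} P gamma.
Arguments eposet {R} P delta gamma.
Arguments V_space {R} P k i f.
Arguments hd_op {R} P alpha f.
Arguments hd_walk {R} P k alpha.
Arguments stripped_threshold_rank {R} P delta k alpha c eta.
Arguments reg_max {R} P k.
Arguments max_delta {R} P delta.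

(* Main.v *)
Require Import Defs.
From HB Require Import structures.
From mathcomp Require Import all_boot all_order all_algebra.
From mathcomp Require Import finmap.
From mathcomp Require Import boolp reals.
From mathcomp Require Import complex.
From mathcomp Require Import ring lra zify.

(** Write 1_S as the sum of its components f_j in V^j.  Pushing D through powers
    of U shows that the V^j are orthogonal up to O(k^2 R gamma) and that D^k_i U^k_i
    is nearly a scalar kappa on ker D_i; non-laziness, by comparing the two ways of
    computing the sum over s of |U^k_i 1_s|^2, gives kappa >= 1/R(k,i) - 2 k^2 gamma.
    Pseudorandomness then bounds <1_S, f_i> by R(k,i) eps_i alpha up to O(gamma).
    For levels above r one needs lambda_j <= eta + O(gamma), and when lambda_r < eta
    one needs eta <= lambda_r + O(gamma).  Each V^j being approximately an
    eigenspace, a dimension count with the spectral theorem puts every eigenvalue of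
    M within min(c_j, O(gamma)) of some lambda_j, which gives both.  As every
    delta_i (1 - delta_(i-1)) is at most 1, the constant c may be taken without the
    denominator; when k^3 R gamma > 1/16 the bound is below 0, hence trivial. *)

Set Implicit Arguments.
Unset Strict Implicit.
Unset Printing Implicit Defensive.

Import Order.TTheory GRing.Theory Num.Theory.

Local Open Scope ring_scope.
Local Open Scope sesquilinear_scope.

(** * Approximate eigenspaces of a real symmetric matrix *)

Section Spectral.
Variable R : rcfType.

(** The radii c_j that define r need not be O(gamma), so an eigenvalue in J_j says little about
    lambda_j itself. They are therefore replaced by min(c_j, O(gamma)): the approximate eigenspace
    bound holds for this radius too, and the smaller intervals remain disjoint. The count then
    yields an eigenvalue near lambda_j provided V^j is not 0, which is a second use of non-laziness.
    The components f_j = U^k_j g_j come from iterating C_(j+1) = ker D + U C_j, which is exact for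
    every gamma; smallness enters through near-orthogonality. Commutation errors are naturally
    relative to |g_j|; the lower bound on kappa makes them relative to |f_j|, and this is the source
    of the factors R_max. An index i <= r with lambda_i < eta raises the claimed lower bound instead
    of lowering it. The rise has to be absorbed by the error term: eta - lambda_i is O(gamma), and
    eps_i <= 1 bounds the other factor. *)

Definition sqnorm n (u : 'rV[R]_n) : R := \sum_j u 0 j ^+ 2.

Local Notation toC := (real_complex R).

Lemma map_conjC_real m n (A : 'M[R]_(m, n)) :
  (map_mx toC A) ^t* = map_mx toC A^T.
Proof. by apply/matrixP => i j; rewrite !mxE; apply: conjc_real. Qed.

(** The spectral theorem lives over [R[i]]; this lets a bound known for real vectors be applied to
    the two parts of a complex one. *)
Lemma dotmx_rect n (x y : 'rV[R]_n) :
  dotmx (map_mx toC x + 'i *: map_mx toC y) (map_mx toC x + 'i *: map_mx toC y)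
  = (sqnorm x + sqnorm y)%:C%C.
Proof.
rewrite dotmxE mxE /sqnorm -big_split /= rmorph_sum /=.
apply: eq_bigr => j _; rewrite !mxE.
rewrite -normCK -add_Re2_Im2 /=.
by rewrite !mul0r !mul1r !add0r ?oppr0 ?subr0 ?addr0.
Qed.

Lemma dotmx_unitary n (P : 'M[R[i]]_n) (u : 'rV_n) : P \is unitarymx ->
  dotmx (u *m P) (u *m P) = \sum_j `|u 0 j| ^+ 2.
Proof.
move=> Pu; rewrite dotmxE trmx_mul map_mxM mulmxA mulmxtVK // mxE.
by apply: eq_bigr => j _; rewrite !mxE normCK.
Qed.

(** If fewer than [\rank V] of the [d t] were within [rho] of [lam], some nonzero complex
    combination of the rows of [V] would have zero coordinates along all those eigenvectors, and
    [A - lam] would stretch it by more than [rho]. Its real and imaginary parts lie in [V], where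
    the hypothesis forbids this. *)
Lemma spectral_rank n (A : 'M[R]_n) : A^T = A ->
  exists d : 'I_n -> R,
   [/\ forall t, eigenvalue A (d t),
       forall mu, eigenvalue A mu -> exists t, mu = d t &
       forall (V : 'M[R]_n) (lam rho : R), 0 <= rho ->
         (forall u : 'rV_n, (u <= V)%MS ->
            sqnorm (u *m A - lam *: u) <= rho ^+ 2 * sqnorm u) ->
         (\rank V <= #|[set t | (`|d t - lam| <= rho)%R]|)%N].
Proof.
move=> Asym; pose B := map_mx toC A.
have Bh : B \is hermsymmx.
  apply/is_hermitianmxP; rewrite expr0 scale1r.
  by rewrite [RHS]map_conjC_real Asym.
have /orthomx_spectralP BE := hermitian_normalmx Bh.
have sr := hermitian_spectral_diag_real Bh.
set P := spectralmx B in BE; set D := spectral_diag B in BE sr.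
have Pu : P \is unitarymx by apply: spectral_unitarymx.
have Punit : P \in unitmx by apply: unitarymx_unit.
pose d t := complex.Re (D 0 t).
have dE t : D 0 t = (d t)%:C%C.
  have /mxOverP/(_ 0 t) := sr.
  by rewrite /d; case: (D 0 t) => a b; rewrite complex_real => /eqP ->.
have PB : P *m B = diag_mx D *m P by rewrite {1}BE !mulmxA mulmxV // mul1mx.
have eigC mu : eigenvalue B mu%:C%C = eigenvalue A mu.
  rewrite !eigenvalue_root_char -map_char_poly.
  by rewrite fmorph_root.
exists d; split.
- move=> t; rewrite -eigC; apply/eigenvalueP; exists (row t P).
    by rewrite -row_mul PB -dE; apply/rowP => j; rewrite mul_diag_mx !mxE.
  apply/eqP => r0; have /unitarymxP/matrixP/(_ t t) := Pu.
  rewrite !mxE eqxx /=; under eq_bigr => j _.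
    have -> : P t j = 0 by have /rowP/(_ j) := r0; rewrite !mxE.
    rewrite mul0r; over.
  by rewrite big1 // => /eqP; rewrite eq_sym oner_eq0.
- move=> mu; rewrite -eigC => /eigenvalueP[v vB v0].
  pose u := v *m invmx P.
  have vE : v = u *m P by rewrite /u -mulmxA mulVmx // mulmx1.
  have u0 : u != 0 by apply: contraNneq v0 => u0; rewrite vE u0 mul0mx.
  clearbody u; have /rV0Pn[t ut] := u0.
  exists t; apply: (@complexI R); rewrite -dE.
  have : u *m diag_mx D = mu%:C%C *: u.
    apply: (can_inj (mulmxK Punit)); rewrite -mulmxA -PB mulmxA -vE vB.
    by rewrite -scalemxAl -vE.
  move/rowP/(_ t); rewrite mul_mx_diag !mxE mulrC => h.
  by apply: esym; apply: (mulIf ut).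
- move=> V lam rho rho0 HV; set I := [set t | _].
  rewrite leqNgt; apply/negP => ltr.
  pose VC := map_mx toC V.
  (* [K] holds the coordinates of a basis of [V] in the eigenbasis; [L] keeps those with index in
     [I]. *)
  pose K := row_base VC *m invmx P.
  pose L : 'M_(_, #|I|) := colsub (fun j => enum_val j) K.
  have : (\rank L < \rank VC)%N.
    by apply: leq_ltn_trans (rank_leq_col _) _; rewrite mxrank_map.
  rewrite -subn_gt0 -mxrank_ker lt0n mxrank_eq0 => /rowV0Pn[w wL w0].
  have wL0 : w *m L = 0 by apply/sub_kermxP.
  pose u := w *m K.
  have zE : u *m P = w *m row_base VC by rewrite /u /K !mulmxA mulmxKV.
  have u0 : u != 0.
    apply: contraNneq w0 => u0; move: zE; rewrite u0 mul0mx => /esym/eqP.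
    by rewrite mulmx_free_eq0 // row_base_free.
  have uI t : t \in I -> u 0 t = 0.
    move=> tI; have /rowP/(_ (enum_rank_in tI t)) := wL0.
    rewrite !mxE => h; rewrite -[RHS]h; apply: eq_bigr => j _.
    by rewrite !mxE enum_rankK_in.
  clearbody u.
  have zV : (u *m P <= VC)%MS.
    by rewrite zE (submx_trans (submxMl _ _)) // eq_row_base.
  have /submxP[y yE] := zV.
  pose y1 := map_mx (@complex.Re R) y; pose y2 := map_mx (@complex.Im R) y.
  have yRI : y = map_mx toC y1 + 'i *: map_mx toC y2.
    by apply/matrixP => a b; rewrite !mxE {1}[y a b]complexE.
  pose x1 := y1 *m V; pose x2 := y2 *m V.
  have zRI : u *m P = map_mx toC x1 + 'i *: map_mx toC x2.
    by rewrite yE yRI mulmxDl -scalemxAl !map_mxM.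
  have zARI : u *m P *m B - lam%:C%C *: (u *m P) =
     map_mx toC (x1 *m A - lam *: x1) + 'i *: map_mx toC (x2 *m A - lam *: x2).
    rewrite zRI; move: (x1) (x2) => a b; rewrite !map_mxB !map_mxM !map_mxZ mulmxDl.
    rewrite -scalemxAl !scalerBr !scalerDr.
    rewrite !scalerA [lam%:C%C * _]mulrC opprD !addrA; congr (_ - _).
    exact: addrAC.
  have zA : u *m P *m B - lam%:C%C *: (u *m P) = (u *m (diag_mx D) - lam%:C%C *: u) *m P.
    by rewrite -mulmxA PB mulmxBl mulmxA -scalemxAl.
  have h1 := dotmx_rect (x1 *m A - lam *: x1) (x2 *m A - lam *: x2).
  rewrite -zARI zA dotmx_unitary // in h1.
  have h2 := dotmx_rect x1 x2; rewrite -zRI dotmx_unitary // in h2.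
  pose q t := Normc.normc (u 0 t) ^+ 2.
  have {}h2 : \sum_t q t = sqnorm x1 + sqnorm x2.
    apply: (@complexI R); rewrite -h2 rmorph_sum; apply: eq_bigr => t _.
    by rewrite /q rmorphXn.
  have {}h1 : \sum_t (d t - lam) ^+ 2 * q t =
      sqnorm (x1 *m A - lam *: x1) + sqnorm (x2 *m A - lam *: x2).
    apply: (@complexI R); rewrite -h1 rmorph_sum; apply: eq_bigr => t _.
    rewrite mul_mx_diag !mxE dE [u 0 t * _]mulrC -mulrBl -rmorphB normrM.
    rewrite normc_def /= expr0n addr0 sqrtr_sqr exprMn -rmorphXn /=.
    by rewrite real_normK ?num_real // rmorphM /q; congr (_ * _); apply: rmorphXn.
  have x1V : (x1 <= V)%MS by apply: submxMl.
  have x2V : (x2 <= V)%MS by apply: submxMl.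
  have : \sum_t (d t - lam) ^+ 2 * q t <= rho ^+ 2 * \sum_t q t.
    by rewrite h1 h2 mulrDr lerD // HV.
  apply/negP; rewrite -ltNge mulr_sumr.
  have q0 t : 0 <= q t by apply: sqr_ge0.
  have sq t : t \notin I -> rho ^+ 2 < (d t - lam) ^+ 2.
    rewrite inE -ltNge => h; rewrite -[ltRHS]real_normK ?num_real //.
    by rewrite ltrXn2r.
  have /rV0Pn[t0 ut0] := u0.
  rewrite (bigD1 t0) // [ltRHS](bigD1 t0) //=; apply: ltr_leD.
    rewrite ltr_pM2r; last first.
      rewrite /q exprn_even_gt0 //=; apply: contraNneq ut0 => h.
      by rewrite (Normc.eq0_normc h).
    by apply: sq; apply: contraNN ut0 => /uI ->.
  apply: ler_sum => t _; have [tI|tI] := boolP (t \in I).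
    by rewrite /q uI // Normc.normc0 expr0n !mulr0.
  by rewrite ler_wpM2r // ltW // sq.
Qed.

(** The sets of indices near the [lam i] are disjoint by separation and have at least [\rank (V i)]
    elements each. As these ranks add up to at least [n], the sets exhaust all [n] indices. *)
Lemma eigenvalue_in_intervals n m (A : 'M[R]_n) (V : 'I_m -> 'M[R]_n)
    (lam rho : 'I_m -> R) :
  A^T = A ->
  (forall i, 0 <= rho i) ->
  (forall i (u : 'rV_n), (u <= V i)%MS ->
     sqnorm (u *m A - lam i *: u) <= rho i ^+ 2 * sqnorm u) ->
  (1%:M <= \sum_i V i)%MS ->
  (forall i j, i != j -> rho i + rho j < `|lam i - lam j|) ->
  (forall mu, eigenvalue A mu -> exists i, `|mu - lam i| <= rho i) /\
  (forall i, V i != 0 -> exists2 mu, eigenvalue A mu & `|mu - lam i| <= rho i).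
Proof.
move=> Asym; have [d [d1 d2 d3]] := spectral_rank Asym; move=> rho0 HV full sep.
pose I i := [set t | `|d t - lam i| <= rho i].
have rkV i : (\rank (V i) <= #|I i|)%N by apply: d3 => // u; apply: HV.
split; last first.
  move=> i; rewrite -mxrank_eq0 -lt0n => /leq_trans/(_ (rkV i)).
  by case/card_gt0P => t; rewrite inE => ht; exists (d t).
move=> mu /d2[t ->] {mu}.
have disj i j : i != j -> [disjoint I i & I j].
  move=> /sep ij; apply/pred0P => s /=; rewrite !inE; apply/negP => /andP[a b].
  move: ij; rewrite ltNge => /negP; apply.
  rewrite -[lam i - lam j](subrKA (d s)) (le_trans (ler_normD _ _)) //.
  by rewrite lerD // distrC.
have : t \in \bigcup_i I i.
  suff -> : \bigcup_i I i = setT by rewrite inE.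
  apply/eqP; rewrite eqEcard subsetT /= cardsT card_ord.
  rewrite -sum1_card (partition_disjoint_bigcup _ (fun=> 1%N)) //=.
  have : (n <= \sum_i \rank (V i))%N.
    rewrite -[leqLHS](@mxrank1 R) (leq_trans (mxrankS full)) //.
    exact: mxrank_sum_leqif.
  by move/leq_trans; apply; apply: leq_sum => i _; rewrite sum1_card.
by case/bigcupP => i _; rewrite inE; exists i.
Qed.

End Spectral.


(** * The operators U and D, their adjointness and contractivity *)

Section Operators.
Variables (R : realType) (P : measured_poset R).
Implicit Types (f g h : {ffun P -> R}) (x y : P) (a b : R) (i j k : nat).

Definition scalef a f : {ffun P -> R} := [ffun x => a * f x].
Definition constf a : {ffun P -> R} := [ffun=> a].

Lemma up_op_is_additive : {morph @up_op R P : f g / f - g}.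
Proof.
by move=> f g; apply/ffunP => y; rewrite !ffunE -mulrBr -sumrB;
  congr (_ * _); apply: eq_bigr => x _; rewrite !ffunE.
Qed.
HB.instance Definition _ := GRing.isZmodMorphism.Build _ _ (@up_op R P)
  up_op_is_additive.

Lemma down_op_is_additive : {morph @down_op R P : f g / f - g}.
Proof.
by move=> f g; apply/ffunP => y; rewrite !ffunE -mulrBl -sumrB;
  congr (_ / _); apply: eq_bigr => x _; rewrite !ffunE mulrBr.
Qed.
HB.instance Definition _ := GRing.isZmodMorphism.Build _ _ (@down_op R P)
  down_op_is_additive.

Lemma scalef_is_additive a : {morph scalef a : f g / f - g}.
Proof. by move=> f g; apply/ffunP => y; rewrite !ffunE mulrBr. Qed.
HB.instance Definition _ a := GRing.isZmodMorphism.Build _ _ (scalef a)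
  (scalef_is_additive a).

Lemma up_scalef a f : up_op (scalef a f) = scalef a (up_op f).
Proof.
apply/ffunP => y; rewrite !ffunE mulrCA; congr (_ * _).
by rewrite mulr_sumr; apply: eq_bigr => x _; rewrite ffunE.
Qed.

Lemma down_scalef a f : down_op (scalef a f) = scalef a (down_op f).
Proof.
apply/ffunP => y; rewrite !ffunE mulrA; congr (_ / _).
by rewrite mulr_sumr; apply: eq_bigr => x _; rewrite ffunE mulrCA.
Qed.

Lemma scalefA a b f : scalef a (scalef b f) = scalef (a * b) f.
Proof. by apply/ffunP => y; rewrite !ffunE mulrA. Qed.

Lemma scalef1 f : scalef 1 f = f.
Proof. by apply/ffunP => y; rewrite !ffunE mul1r. Qed.

Lemma scale0f f : scalef 0 f = 0.
Proof. by apply/ffunP => y; rewrite !ffunE mul0r. Qed.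

Lemma sum_ffunE (I : Type) (s : seq I) (Q : pred I) (F : I -> {ffun P -> R}) x :
  (\sum_(i <- s | Q i) F i) x = \sum_(i <- s | Q i) F i x.
Proof. by elim/big_rec2: _ => [|i a g _ <-]; rewrite ffunE. Qed.

Lemma walk_op_is_additive Y : {morph @walk_op R P Y : f g / f - g}.
Proof. by elim: Y => [|[] Y IH] f g //=; rewrite -IH raddfB. Qed.
HB.instance Definition _ Y := GRing.isZmodMorphism.Build _ _ (@walk_op R P Y)
  (walk_op_is_additive Y).

Lemma walk_scalef Y a f : walk_op Y (scalef a f) = scalef a (walk_op Y f).
Proof.
by elim: Y f => [|[] Y IH] f //=; rewrite -IH ?up_scalef ?down_scalef.
Qed.

Lemma hd_opE alpha f :
  hd_op P alpha f = \sum_(Y <- finsupp alpha) scalef (alpha Y) (walk_op Y f).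
Proof.
apply/ffunP => x; rewrite sum_ffunE ffunE.
by apply: eq_bigr => Y _; rewrite ffunE.
Qed.

Lemma hd_op_is_additive alpha : {morph hd_op P alpha : f g / f - g}.
Proof.
move=> f g; rewrite !hd_opE -sumrB; apply: eq_bigr => Y _.
by rewrite !raddfB.
Qed.
HB.instance Definition _ alpha := GRing.isZmodMorphism.Build _ _
  (hd_op P alpha) (hd_op_is_additive alpha).

Lemma hd_scalef alpha a f : hd_op P alpha (scalef a f) = scalef a (hd_op P alpha f).
Proof.
rewrite !hd_opE raddf_sum /=; apply: eq_bigr => Y _.
by rewrite walk_scalef !scalefA [a * _]mulrC.
Qed.

Lemma piw_ge0 x : 0 <= piw x.
Proof.
rewrite /piw; move Dn : (poset_dim P - rk x)%N => n.
elim: n x Dn => [|n IH] x Dn /=.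
  apply: top_distr_ge0; apply/eqP; rewrite eqn_leq rk_le_dim /=.
  by rewrite -subn_eq0 Dn.
apply: mulr_ge0; first by rewrite invr_ge0.
apply: sumr_ge0 => y /andP[_ /eqP ry].
by apply: IH; rewrite ry subnS Dn.
Qed.

Lemma piw_rec x : (rk x < poset_dim P)%N ->
  piw x = (reg P (rk x).+1 (rk x))%:R^-1 * \sum_(y | below x y) piw y.
Proof.
move=> lt; rewrite {1}/piw -subnSK //=; congr (_ * _).
by apply: eq_bigr => y /andP[_ /eqP ry]; rewrite /piw ry.
Qed.

Lemma inner_ge0 k f : 0 <= inner k f f.
Proof.
by apply: sumr_ge0 => x _; rewrite -mulrA mulr_ge0 ?piw_ge0 // -expr2 sqr_ge0.
Qed.

Lemma innerC k f g : inner k f g = inner k g f.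
Proof. by apply: eq_bigr => x _; ring. Qed.

Lemma innerDl k f g h : inner k (f + g) h = inner k f h + inner k g h.
Proof.
by rewrite /inner -big_split; apply: eq_bigr => x _; rewrite ffunE /=; ring.
Qed.

Lemma innerZl k a f h : inner k (scalef a f) h = a * inner k f h.
Proof.
by rewrite /inner mulr_sumr; apply: eq_bigr => x _; rewrite ffunE; ring.
Qed.

Lemma innerDr k f g h : inner k h (f + g) = inner k h f + inner k h g.
Proof. by rewrite !(innerC k h) innerDl. Qed.

Lemma innerZr k a f h : inner k h (scalef a f) = a * inner k h f.
Proof. by rewrite !(innerC k h) innerZl. Qed.

Lemma innerNl k f h : inner k (- f) h = - inner k f h.
Proof.
by rewrite /inner -sumrN; apply: eq_bigr => x _; rewrite ffunE; ring.
Qed.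

Lemma innerNr k f h : inner k h (- f) = - inner k h f.
Proof. by rewrite !(innerC k h) innerNl. Qed.

Lemma inner0l k h : inner k 0 h = 0.
Proof. by apply: big1 => x _; rewrite ffunE; ring. Qed.

Lemma inner0r k h : inner k h 0 = 0.
Proof. by rewrite innerC inner0l. Qed.

Lemma inner_suml k (I : Type) (s : seq I) (Q : pred I) (F : I -> {ffun P -> R}) h :
  inner k (\sum_(i <- s | Q i) F i) h = \sum_(i <- s | Q i) inner k (F i) h.
Proof. by elim/big_rec2: _ => [|i a g _ <-]; rewrite (inner0l, innerDl). Qed.

Lemma inner_sumr k (I : Type) (s : seq I) (Q : pred I) (F : I -> {ffun P -> R}) h :
  inner k h (\sum_(i <- s | Q i) F i) = \sum_(i <- s | Q i) inner k h (F i).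
Proof. by rewrite innerC inner_suml; apply: eq_bigr => i _; apply: innerC. Qed.

(** The form is only semidefinite: it ignores values off rank [k], and weights at the top rank may
    vanish. Hence the separate case [inner k g g = 0], where the quadratic in [t] is affine and the
    chosen [t] gives it the value -1. *)
Lemma cauchy_schwarz_sqr k f g : inner k f g ^+ 2 <= inner k f f * inner k g g.
Proof.
have q t : 0 <= inner k f f + 2 * t * inner k f g + t ^+ 2 * inner k g g.
  have := inner_ge0 k (f + scalef t g).
  rewrite innerDl !innerDr !innerZl !innerZr (innerC k g f).
  by congr (_ <= _); ring.
have [g0|g0] := eqVneq (inner k g g) 0.
  rewrite g0 mulr0; have [->|i0] := eqVneq (inner k f g) 0; first by rewrite expr0n.
  have := q (- (inner k f f + 1) / (2 * inner k f g)); rewrite g0 mulr0 addr0.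
  suff -> : 2 * (- (inner k f f + 1) / (2 * inner k f g)) * inner k f g
     = - (inner k f f + 1) by lra.
  by field.
have gp : 0 < inner k g g by rewrite lt_def g0 inner_ge0.
have := q (- inner k f g / inner k g g); rewrite -(pmulr_rge0 _ gp).
suff -> : inner k g g * (inner k f f + 2 * (- inner k f g / inner k g g) * inner k f g
   + (- inner k f g / inner k g g) ^+ 2 * inner k g g) =
   inner k f f * inner k g g - inner k f g ^+ 2 by rewrite subr_ge0.
by field.
Qed.

Lemma cnorm_ge0 k f : 0 <= cnorm k f. Proof. exact: sqrtr_ge0. Qed.

Lemma cnorm_sqr k f : cnorm k f ^+ 2 = inner k f f.
Proof. by rewrite sqr_sqrtr ?inner_ge0. Qed.

Lemma cauchy_schwarz k f g : `|inner k f g| <= cnorm k f * cnorm k g.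
Proof.
rewrite -(ler_pXn2r (n := 2)) ?nnegrE ?mulr_ge0 ?cnorm_ge0 //.
by rewrite exprMn !cnorm_sqr real_normK ?num_real // cauchy_schwarz_sqr.
Qed.

Lemma cnormD k f g : cnorm k (f + g) <= cnorm k f + cnorm k g.
Proof.
rewrite -(ler_pXn2r (n := 2)) ?nnegrE ?addr_ge0 ?cnorm_ge0 //.
rewrite sqrrD !cnorm_sqr innerDl !innerDr (innerC k g f).
have := le_trans (ler_norm _) (cauchy_schwarz k f g); lra.
Qed.

Lemma cnormZ k a f : cnorm k (scalef a f) = `|a| * cnorm k f.
Proof.
by rewrite /cnorm innerZl innerZr mulrA -expr2 sqrtrM ?sqr_ge0 // sqrtr_sqr.
Qed.

Lemma cnorm0 k : cnorm k (0 : {ffun P -> R}) = 0.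
Proof. by rewrite /cnorm inner0l sqrtr0. Qed.

Lemma cnorm_sum k (I : Type) (s : seq I) (Q : pred I) (F : I -> {ffun P -> R}) :
  cnorm k (\sum_(i <- s | Q i) F i) <= \sum_(i <- s | Q i) cnorm k (F i).
Proof.
elim/big_rec2: _ => [|i a g _ le]; first by rewrite cnorm0.
by rewrite (le_trans (cnormD _ _ _)) // lerD2l.
Qed.

Lemma cnorm_le k f a : 0 <= a -> inner k f f <= a ^+ 2 -> cnorm k f <= a.
Proof.
by move=> a0 le; rewrite -(ler_pXn2r (n := 2)) ?nnegrE ?cnorm_ge0 // cnorm_sqr.
Qed.

Lemma expectE k f : expect k f = inner k f (constf 1).
Proof. by apply: eq_bigr => x _; rewrite ffunE mulr1. Qed.

Lemma cochain_up i f : cochain i f -> cochain i.+1 (up_op f).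
Proof.
move=> fi y ry; rewrite ffunE big1 ?mulr0 // => x /andP[_ /eqP rx].
by apply: fi; apply: contraNneq ry => <-; rewrite rx.
Qed.

Lemma cochain_down i f : cochain i f -> cochain i.-1 (down_op f).
Proof.
move=> fi x rx; rewrite ffunE big1 ?mul0r // => y /andP[_ /eqP ry].
rewrite fi ?mulr0 //; apply: contraNneq rx => <-; by rewrite ry.
Qed.

Lemma down_cochain0 f : cochain 0 f -> down_op f = 0.
Proof.
move=> f0; apply/ffunP => x; rewrite !ffunE big1 ?mul0r // => y /andP[_ /eqP ry].
by rewrite f0 ?mulr0 // ry.
Qed.

Lemma cochainB i f g : cochain i f -> cochain i g -> cochain i (f - g).
Proof. by move=> fi gi x rx; rewrite !ffunE fi // gi // subrr. Qed.

Lemma cochainD i f g : cochain i f -> cochain i g -> cochain i (f + g).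
Proof. by move=> fi gi x rx; rewrite !ffunE fi // gi // addr0. Qed.

Lemma cochainZ i a f : cochain i f -> cochain i (scalef a f).
Proof. by move=> fi x rx; rewrite !ffunE fi // mulr0. Qed.

Lemma cochain0 i : cochain i (0 : {ffun P -> R}).
Proof. by move=> x _; rewrite ffunE. Qed.

Lemma cochain_sum k (I : Type) (s : seq I) (Q : pred I) (F : I -> {ffun P -> R}) :
  (forall t, Q t -> cochain k (F t)) -> cochain k (\sum_(i <- s | Q i) F i).
Proof.
move=> H; elim/big_rec: _ => [|t g Qt gk]; first exact: cochain0.
by apply: cochainD => //; apply: H.
Qed.

Lemma up_kiS k i f : (i <= k)%N -> up_ki k.+1 i f = up_op (up_ki k i f).
Proof. by move=> ik; rewrite /up_ki subSn. Qed.

Lemma up_kinn i f : up_ki i i f = f. Proof. by rewrite /up_ki subnn. Qed.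
Lemma down_kinn i f : down_ki i i f = f. Proof. by rewrite /down_ki subnn. Qed.

Lemma down_kiS k i f : (i <= k)%N -> down_ki k.+1 i f = down_ki k i (down_op f).
Proof. by move=> ik; rewrite /down_ki subSn // iterSr. Qed.

Lemma cochain_up_ki k i f : (i <= k)%N -> cochain i f -> cochain k (up_ki k i f).
Proof.
move=> ik fi; rewrite -(subnKC ik); elim: (k - i)%N => [|m IH].
  by rewrite addn0 up_kinn.
by rewrite addnS up_kiS ?leq_addr //; apply: cochain_up.
Qed.

Lemma up_ki_is_additive k i : {morph @up_ki R P k i : f g / f - g}.
Proof.
by rewrite /up_ki => f g; elim: (k - i)%N => //= m ->; rewrite raddfB.
Qed.
HB.instance Definition _ k i := GRing.isZmodMorphism.Build _ _ (@up_ki R P k i)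
  (up_ki_is_additive k i).

Lemma down_ki_is_additive k i : {morph @down_ki R P k i : f g / f - g}.
Proof.
by rewrite /down_ki => f g; elim: (k - i)%N => //= m ->; rewrite raddfB.
Qed.
HB.instance Definition _ k i := GRing.isZmodMorphism.Build _ _ (@down_ki R P k i)
  (down_ki_is_additive k i).

Lemma up_ki_scalef k i a f : up_ki k i (scalef a f) = scalef a (up_ki k i f).
Proof. by rewrite /up_ki; elim: (k - i)%N => //= m ->; rewrite up_scalef. Qed.

Lemma down_ki_scalef k i a f : down_ki k i (scalef a f) = scalef a (down_ki k i f).
Proof. by rewrite /down_ki; elim: (k - i)%N => //= m ->; rewrite down_scalef. Qed.

Lemma up_op_mono f g : (forall x, f x <= g x) -> forall x, up_op f x <= up_op g x.
Proof. by move=> fg x; rewrite !ffunE ler_wpM2l ?invr_ge0 //; apply: ler_sum. Qed.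

Lemma down_op_mono f g : (forall x, f x <= g x) -> forall x, down_op f x <= down_op g x.
Proof.
move=> fg x; rewrite !ffunE ler_wpM2r //.
  by rewrite invr_ge0 sumr_ge0 // => y _; apply: piw_ge0.
by apply: ler_sum => y _; rewrite ler_wpM2l // piw_ge0.
Qed.

Section WellDefined.
Hypothesis Dwd : D_well_defined P.
Local Notation d := (poset_dim P).

Lemma exists_above x : (rk x < d)%N -> exists y, below x y.
Proof.
move=> /Dwd sx; case: (pickP (below x)) => [y xy|no]; first by exists y.
by move: sx; rewrite big_pred0 // ltxx.
Qed.

Lemma exists_chain x k : (rk x <= k)%N -> (k <= d)%N -> exists2 y, (x <= y)%O & rk y = k.
Proof.
move=> xk; rewrite -(subnKC xk); elim: (k - rk x)%N => [|m IH] md.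
  by exists x; rewrite ?lexx ?addn0.
have [|y xy ry] := IH; first by apply: leq_trans md; rewrite addnS.
have [|z /andP[yz /eqP rz]] := @exists_above y; first by rewrite ry -addnS.
by exists z; [exact: le_trans xy (ltW yz) | rewrite rz ry addnS].
Qed.

Lemma exists_rk k : (k <= d)%N -> exists x : P, rk x = k.
Proof.
move=> kd; have : (0 < #|[set x : P | rk x == 0%N]|)%N by rewrite card_rk0.
case/card_gt0P => x; rewrite inE => /eqP rx.
by have [|y _ ry] := @exists_chain x k _ kd; rewrite ?rx //; exists y.
Qed.

Lemma reg_gt0 k i : (i <= k)%N -> (k <= d)%N -> (0 < reg P k i)%N.
Proof.
move=> ik kd; have [x rx] := exists_rk (leq_trans ik kd).
have [|y xy ry] := @exists_chain x k _ kd; first by rewrite rx.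
rewrite -(regP ik ry); apply/card_gt0P; exists x.
by rewrite inE rx eqxx.
Qed.

Lemma card_below y : (0 < rk y)%N -> #|[set x | below x y]| = reg P (rk y) (rk y).-1.
Proof.
move=> ry; rewrite -(regP (leq_pred _) (erefl (rk y))); apply: eq_card => x.
rewrite !inE /below; apply/andP/andP => [[xy /eqP ->]|[/eqP rx]].
  by rewrite ltW.
rewrite le_eqVlt => /orP[/eqP xy|->].
  move: rx ry; rewrite xy; case: (rk y) => // n /eqP.
  by rewrite /= -[_ == _]negbK neq_ltn ltnSn orbT.
by rewrite rx prednK.
Qed.

Lemma sum_below_const y a : (0 < rk y)%N ->
  \sum_(x | below x y) a = (reg P (rk y) (rk y).-1)%:R * a.
Proof. by move=> ry; rewrite sumr_const -card_below // cardsE mulr_natl. Qed.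

Lemma piw_gt0 x : (rk x < d)%N -> 0 < piw x.
Proof.
move=> lt; rewrite piw_rec // mulr_gt0 ?Dwd // invr_gt0 ltr0n.
exact: reg_gt0.
Qed.

(** Both sides are one sum over pairs [below x y]: the factor 1/R(i+1,i) of U is also the one in the
    recursion for the weights, whose sum cancels the denominator of D. *)
Lemma inner_up i f g : (i < d)%N -> inner i.+1 (up_op f) g = inner i f (down_op g).
Proof.
move=> id; rewrite /inner.
transitivity (\sum_(y | rk y == i.+1) \sum_(x | below x y)
   (reg P i.+1 i)%:R^-1 * (piw y * f x * g y)).
  apply: eq_bigr => y /eqP ry; rewrite ffunE ry /= !mulr_sumr mulr_suml.
  by apply: eq_bigr => x _; ring.
rewrite (exchange_big_dep (fun x => rk x == i)) /=; last first.
  by move=> y x /eqP ry /andP[_]; rewrite ry eqSS eq_sym.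
apply: eq_bigr => x /eqP rx; rewrite ffunE piw_rec ?rx //.
have s0 : \sum_(y | below x y) piw y != 0 by rewrite gt_eqF // Dwd // rx.
rewrite (eq_bigl (below x)); last first.
  by move=> y; rewrite /below rx; case: (rk y == i.+1); rewrite ?andbT ?andbF.
rewrite -mulr_sumr -!mulrA; congr (_ * _).
rewrite [RHS]mulrCA [RHS]mulrC mulrA mulrC; under eq_bigr do rewrite -mulrA mulrCA.
rewrite -mulr_sumr; field.
exact: s0.
Qed.

Lemma up_constf a i y : rk y = i.+1 -> up_op (constf a) y = a.
Proof.
move=> ry; rewrite ffunE; under eq_bigr do rewrite ffunE.
rewrite sum_below_const ?ry //= mulKf // pnatr_eq0 -lt0n.
by rewrite reg_gt0 // -ry rk_le_dim.
Qed.

Lemma down_constf a x : (rk x < d)%N -> down_op (constf a) x = a.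
Proof.
move=> rx; rewrite ffunE; under eq_bigr do rewrite ffunE.
by rewrite -mulr_suml mulrAC mulfV ?mul1r // gt_eqF // Dwd.
Qed.

Lemma eq_inner k f f' g g' : (forall x, rk x = k -> f x = f' x) ->
  (forall x, rk x = k -> g x = g' x) -> inner k f g = inner k f' g'.
Proof. by move=> ff gg; apply: eq_bigr => x /eqP rx; rewrite ff // gg. Qed.

Lemma expect_up i f : (i < d)%N -> expect i.+1 (up_op f) = expect i f.
Proof.
move=> id; rewrite !expectE inner_up //; apply: eq_inner => // x rx.
by rewrite down_constf ?rx // ffunE.
Qed.

Lemma expect_down i f : (i < d)%N -> expect i (down_op f) = expect i.+1 f.
Proof.
move=> id; rewrite !expectE innerC -inner_up // innerC; apply: eq_inner => // y ry.
by rewrite (up_constf _ ry) ffunE.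
Qed.

Lemma sum_piw k : (k <= d)%N -> \sum_(x : P | rk x == k) piw x = 1.
Proof.
have E j : \sum_(x : P | rk x == j) piw x = expect j (constf 1).
  by apply: eq_bigr => x _; rewrite ffunE mulr1.
move=> kd; rewrite -(subKn kd); elim: (d - k)%N => [|n IH].
  rewrite subn0 -(top_distr_sum P); apply: eq_bigr => x /eqP rx.
  by rewrite /piw rx subnn.
(* The induction is on the codimension [n]; from [d] on, the truncated [d - n] stays 0. *)
have [lt|ge] := ltnP n d; last first.
  have [e1 e2] : (d - n = 0 /\ d - n.+1 = 0)%N by lia.
  by rewrite e2 -e1.
have jE : (d - n)%N = (d - n.+1).+1 by rewrite subnSK.
rewrite E -expect_up -?jE ?leq_subr //; apply: etrans IH.
rewrite jE E; apply: eq_bigr => y /eqP ry.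
by rewrite (up_constf _ ry) ffunE.
Qed.

(** Jensen for the uniform average over the lower covers of [y], read off from the sum of squared
    deviations from the mean [m]. *)
Lemma up_op_sqr i f y : rk y = i.+1 ->
  up_op f y ^+ 2 <= up_op [ffun x => f x ^+ 2] y.
Proof.
move=> ry; have rp : (0 : R) < (reg P i.+1 i)%:R.
  by rewrite ltr0n reg_gt0 // -ry rk_le_dim.
set m := up_op f y.
have mE : \sum_(x | below x y) f x = (reg P i.+1 i)%:R * m.
  by rewrite /m ffunE ry /= mulVKf // gt_eqF.
have : 0 <= \sum_(x | below x y) (f x - m) ^+ 2.
  by apply: sumr_ge0 => x _; apply: sqr_ge0.
rewrite (eq_bigr (fun x => f x ^+ 2 + (m ^+ 2 - (2 * m) * f x))); last first.
  by move=> x _; ring.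
rewrite big_split sumrB /= sum_below_const ?ry //= -mulr_sumr mE => h.
rewrite ffunE ry /= mulrC ler_pdivlMr //.
under eq_bigr do rewrite ffunE.
by rewrite -subr_ge0; move: h; congr (_ <= _); ring.
Qed.

Lemma inner_up_le i f : (i < d)%N -> inner i.+1 (up_op f) (up_op f) <= inner i f f.
Proof.
move=> id; have -> : inner i f f = expect i.+1 (up_op [ffun x => f x ^+ 2]).
  by rewrite expect_up //; apply: eq_bigr => x _; rewrite ffunE; ring.
apply: ler_sum => y /eqP ry; rewrite -mulrA ler_wpM2l ?piw_ge0 // -expr2.
exact: up_op_sqr ry.
Qed.

Lemma cnorm_up i f : (i < d)%N -> cnorm i.+1 (up_op f) <= cnorm i f.
Proof. by move=> id; rewrite ler_wsqrtr // inner_up_le. Qed.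

(** By duality: |D f|^2 = <U D f, f> <= |D f| |f|, as U is a contraction. *)
Lemma cnorm_down i f : (i < d)%N -> cnorm i (down_op f) <= cnorm i.+1 f.
Proof.
move=> id; have [->|n0] := eqVneq (cnorm i (down_op f)) 0; first exact: cnorm_ge0.
have np : 0 < cnorm i (down_op f) by rewrite lt_def n0 cnorm_ge0.
rewrite -(ler_pM2l np) -expr2 cnorm_sqr -inner_up //.
apply: le_trans (ler_norm _) (le_trans (cauchy_schwarz _ _ _) _).
by rewrite ler_wpM2r ?cnorm_ge0 // cnorm_up.
Qed.

Lemma cnorm_up_ki k i f : (i <= k)%N -> (k <= d)%N -> cnorm k (up_ki k i f) <= cnorm i f.
Proof.
move=> ik; rewrite -(subnKC ik); elim: (k - i)%N => [|m IH] kd.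
  by rewrite addn0 up_kinn.
rewrite addnS up_kiS ?leq_addr //.
rewrite (le_trans (cnorm_up _ _)) ?IH //; rewrite addnS in kd => //.
exact: ltnW.
Qed.

Lemma inner_up_ki k i f g : (i <= k)%N -> (k <= d)%N ->
  inner k (up_ki k i f) g = inner i f (down_ki k i g).
Proof.
move=> ik; rewrite -(subnKC ik); elim: (k - i)%N g => [|m IH] g kd.
  by rewrite addn0 up_kinn down_kinn.
rewrite addnS in kd *.
by rewrite up_kiS ?leq_addr // down_kiS ?leq_addr // inner_up // IH // ltnW.
Qed.

Lemma expect_down_ki k i f : (i <= k)%N -> (k <= d)%N -> expect i (down_ki k i f) = expect k f.
Proof.
move=> ik; rewrite -(subnKC ik); elim: (k - i)%N f => [|m IH] f kd.
  by rewrite addn0 down_kinn.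
rewrite addnS in kd *.
by rewrite down_kiS ?leq_addr // IH ?expect_down // ltnW.
Qed.

Lemma cnorm_eq0 k f : (k < d)%N -> cochain k f -> cnorm k f = 0 -> f = 0.
Proof.
move=> kd fk /(congr1 (fun t => t ^+ 2)); rewrite cnorm_sqr expr0n /= => /eqP.
rewrite psumr_eq0; last first.
  by move=> x _; rewrite -mulrA mulr_ge0 ?piw_ge0 // -expr2 sqr_ge0.
move=> /allP fE; apply/ffunP => x; rewrite ffunE.
have [rx|/fk //] := eqVneq (rk x) k.
have := fE x (mem_index_enum _); rewrite rx eqxx /= => /eqP/eqP.
by rewrite -mulrA -expr2 mulf_eq0 gt_eqF ?piw_gt0 ?rx //= sqrf_eq0 => /eqP.
Qed.

End WellDefined.
End Operators.


(** * Levels as coordinate spaces, and their decomposition into the V^j *)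

Section LevelMatrices.
Variables (R : realType) (P : measured_poset R).
Hypothesis Dwd : D_well_defined P.
Local Notation d := (poset_dim P).
Implicit Types (f g h : {ffun P -> R}) (x y : P) (a b : R) (i j k l : nat).

Definition level k : {pred P} := [pred x : P | rk x == k].

(* The weights make the coordinates orthonormal. *)
Definition encode k f : 'rV[R]_#|level k| :=
  \row_j (Num.sqrt (piw (enum_val j)) * f (enum_val j)).

Definition decode k (u : 'rV[R]_#|level k|) : {ffun P -> R} :=
  [ffun x => \sum_j (enum_val j == x)%:R * (u 0 j / Num.sqrt (piw x))].

Lemma rk_enum_val k (j : 'I_#|level k|) : rk (enum_val j) = k.
Proof. exact/eqP/(enum_valP j). Qed.

Lemma sqrt_piw_neq0 k (j : 'I_#|level k|) : (k < d)%N ->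
  Num.sqrt (piw (enum_val j)) != 0.
Proof.
by move=> kd; rewrite gt_eqF // sqrtr_gt0 piw_gt0 // rk_enum_val.
Qed.

Lemma decode_enum_val k u (j : 'I_#|level k|) :
  decode u (enum_val j) = u 0 j / Num.sqrt (piw (enum_val j)).
Proof.
rewrite ffunE (bigD1 j) //= eqxx mul1r big1 ?addr0 // => i ij.
by rewrite (inj_eq enum_val_inj) (negPf ij) mul0r.
Qed.

Lemma cochain_decode k u : cochain k (@decode k u).
Proof.
move=> x rx; rewrite ffunE big1 // => j _.
by rewrite (_ : _ == x = false) ?mul0r //; apply: contraNF rx => /eqP <-; rewrite rk_enum_val.
Qed.

Lemma decodeK k (u : 'rV_#|level k|) : (k < d)%N -> encode k (decode u) = u.
Proof.
move=> kd; apply/rowP => j; rewrite mxE decode_enum_val mulrC divfK //.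
exact: sqrt_piw_neq0.
Qed.

Lemma encodeK k f : (k < d)%N -> cochain k f -> decode (encode k f) = f.
Proof.
move=> kd fk; apply/ffunP => x; have [rx|rx] := eqVneq (rk x) k; last first.
  by rewrite fk // cochain_decode.
have xk : x \in level k by apply/eqP.
rewrite -(enum_rankK_in xk xk) decode_enum_val mxE mulrAC mulfV ?mul1r //.
exact: sqrt_piw_neq0.
Qed.

Lemma encode_inner k f g : \sum_j encode k f 0 j * encode k g 0 j = inner k f g.
Proof.
rewrite /inner (big_enum_val (A := level k)).
apply: eq_bigr => j _; rewrite !mxE mulrACA -expr2 sqr_sqrtr ?piw_ge0 //.
by rewrite mulrA.
Qed.

Lemma encode_sqnorm k f : sqnorm (encode k f) = inner k f f.
Proof. by rewrite -encode_inner; apply: eq_bigr => j _; rewrite expr2. Qed.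

Lemma encode_is_additive k : {morph encode k : f g / f - g}.
Proof. by move=> f g; apply/rowP => j; rewrite !mxE !ffunE mulrBr. Qed.
HB.instance Definition _ k := GRing.isZmodMorphism.Build _ _ (encode k)
  (@encode_is_additive k).

Lemma encode_scalef k a f : encode k (scalef a f) = a *: encode k f.
Proof. by apply/rowP => j; rewrite !mxE !ffunE mulrCA. Qed.

Lemma decode_is_additive k : {morph @decode k : f g / f - g}.
Proof.
move=> u v; apply/ffunP => x; rewrite !ffunE -sumrB.
by apply: eq_bigr => j _; rewrite !mxE mulrBl mulrBr.
Qed.
HB.instance Definition _ k := GRing.isZmodMorphism.Build _ _ (@decode k)
  (@decode_is_additive k).

Lemma decode_scale k a u : @decode k (a *: u) = scalef a (decode u).
Proof.
apply/ffunP => x; rewrite !ffunE mulr_sumr.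
by apply: eq_bigr => j _; rewrite mxE -mulrA mulrCA.
Qed.

Lemma operator_matrix k l (T : {ffun P -> R} -> {ffun P -> R}) :
  {morph T : f g / f - g} -> (forall a f, T (scalef a f) = scalef a (T f)) ->
  exists A, forall u, u *m A = encode l (T (@decode k u)).
Proof.
move=> TB TZ; pose F u := encode l (T (@decode k u)).
have FB : zmod_morphism F by move=> u v; rewrite /F raddfB TB raddfB.
have FZ : scalable F by move=> a u; rewrite /F decode_scale TZ encode_scalef.
pose FA := GRing.isZmodMorphism.Build _ _ F FB.
pose FS := GRing.isScalable.Build _ _ _ _ F FZ.
pose FL : {linear _ -> _} := HB.pack F FA FS.
by exists (lin1_mx FL) => u; rewrite mul_rV_lin1.
Qed.

Lemma encode_mul k f g :
  encode k f *m (encode k g)^T = (inner k f g)%:M.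
Proof.
apply/matrixP => i j; rewrite !ord1 [LHS]mxE [RHS]mxE eqxx mulr1n -encode_inner.
by apply: eq_bigr => s _; congr (_ * _); apply: mxE.
Qed.

(* C_(k+1) = ker D_(k+1) + U_k C_k, by solving the normal equations. *)
Lemma up_projection k f : (k.+1 < d)%N -> cochain k.+1 f ->
  exists2 g, cochain k g & down_op (f - up_op g) = 0.
Proof.
move=> kd fk; have kd' := ltnW kd.
have [B BE] := @operator_matrix k k.+1 _ (@up_op_is_additive R P) (@up_scalef R P).
(* In orthonormal coordinates the adjoint D of U is the transpose. *)
have BT v : v *m B^T = encode k (down_op (decode v)).
  apply: (can_inj (fun w => trmxK w)); rewrite trmx_mul trmxK.
  apply/row_matrixP => i; rewrite row_mul; apply/rowP => j; rewrite !ord1.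
  have -> : row i B = encode k.+1 (up_op (decode (delta_mx 0 i))).
    by rewrite -BE -rowE.
  rewrite -{1}(decodeK v) // -/(encode _ _) encode_mul inner_up //.
  have := encode_mul k (decode (delta_mx 0 i)) (down_op (decode v)).
  rewrite decodeK // => /matrixP/(_ 0 0); rewrite -rowE !mxE eqxx => <-.
  by [].
(* Solvability of the normal equations: if [K] annihilates [B *m B^T], then [W = B^T *m K] satisfies
   [W^T *m W = 0] and so vanishes over the reals. *)
have BBT : (B^T <= B *m B^T)%MS.
  rewrite submxE; set K := cokermx _.
  have K0 : B *m B^T *m K = 0 by apply: mulmx_coker.
  have : (B^T *m K)^T *m (B^T *m K) = 0.
    by rewrite trmx_mul trmxK -mulmxA (mulmxA B) K0 mulmx0.
  move: (B^T *m K) => W /matrixP S0; apply/eqP/matrixP => i j; rewrite [RHS]mxE.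
  have := S0 j j; rewrite !mxE.
  under eq_bigr do rewrite mxE -expr2.
  move/eqP; rewrite psumr_eq0; last by move=> s _; apply: sqr_ge0.
  by move/allP/(_ i (mem_index_enum _)); rewrite /= sqrf_eq0 => /eqP.
have /submxP[w wE] : (encode k.+1 f *m B^T <= B *m B^T)%MS.
  exact: submx_trans (submxMl _ _) BBT.
exists (decode w); first exact: cochain_decode.
have ck : cochain k.+1 (f - up_op (decode w)).
  by apply: cochainB => //; apply: cochain_up; apply: cochain_decode.
have := cochain_down ck; rewrite /= => /(encodeK kd') <-.
have -> : f - up_op (decode w) = decode (encode k.+1 f - w *m B).
  by rewrite raddfB /= encodeK // BE encodeK //; apply: cochain_up; apply: cochain_decode.
by rewrite -BT mulmxBl wE mulmxA subrr raddf0.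
Qed.

(** Each step keeps the part in ker D and recurses on the cochain one rank down whose image under U
    is the rest. *)
Lemma level_decomposition k f : (k < d)%N -> cochain k f ->
  exists g : nat -> {ffun P -> R}, (forall j, H_space j (g j)) /\
    f = \sum_(0 <= j < k.+1) up_ki k j (g j).
Proof.
elim: k f => [|k IH] f kd fk.
  exists (fun j => if j == 0%N then f else 0); split.
    case=> [|j]; first by split.
    by split => //=; [exact: cochain0 | rewrite raddf0].
  by rewrite big_nat1 up_kinn.
have [f' f'k Df'] := up_projection kd fk.
have [g [gH gE]] := IH f' (ltnW kd) f'k.
exists (fun j => if j == k.+1 then f - up_op f' else g j); split.
  move=> j; case: eqVneq => [->|_]; last exact: gH.
  by split => //; apply: cochainB => //; apply: cochain_up.
rewrite big_nat_recr //= eqxx up_kinn.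
rewrite -{1}[f](subrK (up_op f')) addrC; congr (_ + _).
rewrite {1}gE raddf_sum; apply: eq_big_nat => j /andP[_ jk].
by rewrite ltn_eqF // up_kiS.
Qed.

Lemma V_space_matrix k j : (k < d)%N -> (j <= k)%N ->
  exists V : 'M[R]_#|level k|,
    forall u, (u <= V)%MS <-> V_space P k j (decode u).
Proof.
move=> kd jk; have jd := leq_ltn_trans jk kd.
have [A AE] := @operator_matrix j k _ (@up_ki_is_additive R P k j) (@up_ki_scalef R P k j).
have [B BE] := @operator_matrix j j.-1 _ (@down_op_is_additive R P) (@down_scalef R P).
have jd' := leq_ltn_trans (leq_pred j) jd.
(* The row space is made a square matrix so that all levels share one type. For [j = 0] also [j.-1]
   is 0 and [B] is the zero matrix, whose kernel is all of C_0, as H^0 should be. *)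
exists <<kermx B *m A>>%MS => u; rewrite genmxE; split.
  move/submxP => [w]; rewrite mulmxA => ->.
  exists (decode (w *m kermx B)).
    split; first exact: cochain_decode.
    move=> j0; have := cochain_down (@cochain_decode j (w *m kermx B)).
    move/(encodeK jd') <-.
    by rewrite -BE -mulmxA mulmx_ker mulmx0 raddf0.
  rewrite AE encodeK //; apply: cochain_up_ki => //; exact: cochain_decode.
case=> g [gj gD] uE.
have : u = encode j g *m A by rewrite AE encodeK // -uE decodeK.
move=> ->; apply: submxMr; apply/sub_kermxP; rewrite BE encodeK //.
case: (posnP j) => [j0|/gD ->]; last by rewrite raddf0.
by rewrite down_cochain0 ?raddf0 // -j0.
Qed.

(** Transports the interval count to level [k]: self-adjointness becomes symmetry in the orthonormal
    coordinates, and [level_decomposition] says that the V^j span. *)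
Lemma level_eigenvalues k (T : {ffun P -> R} -> {ffun P -> R})
    (lam rho : nat -> R) : (k < d)%N ->
  {morph T : f g / f - g} -> (forall a f, T (scalef a f) = scalef a (T f)) ->
  (forall f, cochain k f -> cochain k (T f)) -> self_adjoint k T ->
  (forall j, (j <= k)%N -> 0 <= rho j) ->
  (forall j f, (j <= k)%N -> V_space P k j f ->
     cnorm k (T f - scalef (lam j) f) <= rho j * cnorm k f) ->
  (forall i j, (i < j <= k)%N -> rho i + rho j < lam i - lam j) ->
  (forall mu, eigenvalue_on k T mu -> exists2 j, (j <= k)%N & `|mu - lam j| <= rho j) /\
  (forall j f, (j <= k)%N -> V_space P k j f -> f != 0 ->
    exists2 mu, eigenvalue_on k T mu & `|mu - lam j| <= rho j).
Proof.
move=> kd TB TZ Tk Tsa rho0 HV sep.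
have [A AE] := operator_matrix k k TB TZ.
have decT u : decode (u *m A) = T (decode u).
  by rewrite AE encodeK //; apply: Tk; apply: cochain_decode.
have Asym : A^T = A.
  apply/matrixP => i j; rewrite mxE.
  have E s t : A s t = inner k (T (decode (delta_mx 0 s))) (decode (delta_mx 0 t)).
    have := encode_mul k (T (decode (delta_mx 0 s))) (decode (delta_mx 0 t)).
    rewrite -AE decodeK // => /matrixP/(_ 0 0); rewrite [RHS]mxE mulr1n => <-.
    rewrite -rowE mxE (bigD1 t) //= !mxE !eqxx mulr1 big1 ?addr0 // => q qt.
    by rewrite !mxE (negPf qt) andbF mulr0.
  rewrite (E i j) (E j i) Tsa; first exact: innerC.
    exact: cochain_decode.
  exact: cochain_decode.
have HVm (j : 'I_k.+1) := V_space_matrix kd (ltn_ord j).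
pose V (t : 'I_k.+1) := projT1 (cid (HVm t)).
have VP (j : 'I_k.+1) u : (u <= V j)%MS <-> V_space P k j (decode u) by rewrite /V; case: cid.
have eigE mu : eigenvalue A mu <-> eigenvalue_on k T mu.
  split=> [/eigenvalueP[v vA v0]|[f [fk f0 Tf]]].
    exists (decode v); split; first exact: cochain_decode.
      by apply: contraNneq v0 => v0; rewrite -(decodeK v kd) v0 raddf0.
    by rewrite -decT vA decode_scale.
  apply/eigenvalueP; exists (encode k f).
    by rewrite AE encodeK // Tf encode_scalef.
  by apply: contraNneq f0 => f0; rewrite -(encodeK kd fk) f0 raddf0.
have [||||e1 e2] := @eigenvalue_in_intervals R _ k.+1 A V
  (fun j : 'I_k.+1 => lam j) (fun j : 'I_k.+1 => rho j) Asym.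
- by move=> j; apply: rho0; rewrite -ltnS.
- move=> j u /VP uV; rewrite AE.
  have -> : encode k (T (decode u)) - lam j *: u
      = encode k (T (decode u) - scalef (lam j) (decode u)).
    by rewrite raddfB /= encode_scalef decodeK.
  have -> : sqnorm u = inner k (decode u) (decode u).
    by rewrite -encode_sqnorm decodeK.
  have jk : (j <= k)%N by rewrite -ltnS.
  rewrite encode_sqnorm -!cnorm_sqr -exprMn lerXn2r ?nnegrE ?mulr_ge0 ?cnorm_ge0 ?rho0 //.
  exact: HV.
- apply/row_subP => s; rewrite row1.
  have [g [gH gE]] := level_decomposition kd (@cochain_decode k (delta_mx 0 s)).
  rewrite -(decodeK (delta_mx 0 s) kd) gE raddf_sum big_mkord /=.
  apply: summx_sub_sums => j _; apply/VP; rewrite encodeK //; last first.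
    by apply: cochain_up_ki; [rewrite -ltnS | case: (gH j)].
  by exists (g j).
- move=> i j ij.
  have [lt|lt|/val_inj E] := ltngtP i j; last by rewrite E eqxx in ij.
    by apply: lt_le_trans (ler_norm _); apply: sep; rewrite lt -ltnS /=.
  rewrite distrC addrC; apply: lt_le_trans (ler_norm _).
  by apply: sep; rewrite lt -ltnS /=.
split=> [mu /eigE/e1[j le]|j f jk fV f0].
  by exists j => //; rewrite -ltnS.
rewrite -ltnS in jk; have [|mu /eigE] := e2 (Ordinal jk); last by exists mu.
have fk : cochain k f.
  by case: fV => g [gj _] ->; apply: cochain_up_ki.
have : (encode k f <= V (Ordinal jk))%MS by apply/VP; rewrite encodeK.
apply: contraTneq => ->; rewrite submx0.
by apply: contraNneq f0 => f0; rewrite -(encodeK kd fk) f0 raddf0.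
Qed.

End LevelMatrices.


(** * Commutation of D with powers of U, and non-laziness *)

Section EposetCalculus.
Variables (R : realType) (P : measured_poset R).
Variables (delta : nat -> R) (gamma : R).
Hypothesis Dwd : D_well_defined P.
Hypothesis Pep : eposet P delta gamma.
Hypothesis Pnl : non_lazy P gamma.
Local Notation d := (poset_dim P).
Hypothesis d_gt0 : (0 < d)%N.
Implicit Types (f g h : {ffun P -> R}) (x y : P) (a b : R) (i j k l m : nat).

Lemma delta01 i : (i < d)%N -> 0 <= delta i <= 1.
Proof.
case: Pep => d0 d1 _ _; case: i => [|i] id; first by rewrite d0 lexx ler01.
exact: d1.
Qed.

Lemma indic_cochain x : cochain (rk x) (indic [set x]).
Proof.
move=> y ry; rewrite ffunE inE; case: eqP => // E.
by rewrite E eqxx in ry.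
Qed.

Lemma inner_indic x f : inner (rk x) f (indic [set x]) = piw x * f x.
Proof.
rewrite /inner (bigD1 x) //= ffunE inE eqxx mulr1 big1 ?addr0 // => y /andP[_ yx].
by rewrite ffunE inE (negPf yx) mulr0.
Qed.

Lemma up_op_ge0 f : (forall x, 0 <= f x) -> forall y, 0 <= up_op f y.
Proof. by move=> f0 y; rewrite ffunE mulr_ge0 ?invr_ge0 ?sumr_ge0. Qed.

Lemma down_op_ge0 f : (forall x, 0 <= f x) -> forall y, 0 <= down_op f y.
Proof.
move=> f0 y; rewrite ffunE divr_ge0 // sumr_ge0 // => x _; last exact: piw_ge0.
by rewrite mulr_ge0 ?piw_ge0.
Qed.

(** A return probability is nonnegative, and [0 < d] provides a point of rank 1 at which to read
    one. *)
Lemma gamma_ge0 : 0 <= gamma.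
Proof.
have [x rx] := exists_rk Dwd d_gt0.
have rx0 : (0 < rk x)%N by rewrite rx.
apply: le_trans (Pnl rx0); rewrite /transition /=.
apply: up_op_ge0 => y; apply: down_op_ge0 => w.
by rewrite ffunE ler0n.
Qed.

Lemma down_up_cochain0 f x : cochain 0 f -> rk x = 0%N -> down_op (up_op f) x = f x.
Proof.
move=> f0 rx; have U y : below x y -> up_op f y = f x.
  move=> /andP[xy /eqP ry]; have := up_constf Dwd (f x) ry; rewrite rx in ry * => <-.
  rewrite !ffunE; congr (_ * _); apply: eq_bigr => z /andP[_ /eqP rz].
  have : x \in [set x : P | rk x == 0%N] by rewrite inE rx.
  have : z \in [set x : P | rk x == 0%N] by rewrite inE; apply/eqP; lia.
  have /eqP/cards1P[t ->] := card_rk0 P.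
  by rewrite !inE ffunE => /eqP -> /eqP ->.
have := down_constf Dwd (f x) (_ : (rk x < d)%N); rewrite rx => /(_ d_gt0) <-.
rewrite !ffunE; congr (_ / _); apply: eq_bigr => y xy; congr (_ * _).
by rewrite (U y xy) ffunE.
Qed.

(** Extends the eposet inequality to [i = 0], where the convention delta_0 = 0 turns it into the
    exact identity D_1 U_0 = I. *)
Lemma down_up_approx i f : (i < d)%N -> cochain i f ->
  cnorm i (down_op (up_op f) - scalef (1 - delta i) f
            - scalef (delta i) (up_op (down_op f))) <= gamma * cnorm i f.
Proof.
case: Pep => d0 _ _ H id fi; case: (posnP i) => [i0|ip].
  rewrite i0 d0 scale0f subr0 subr0 scalef1 in fi *.
  rewrite [leLHS](_ : _ = 0) ?mulr_ge0 ?gamma_ge0 ?cnorm_ge0 //.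
  rewrite /cnorm (_ : inner _ _ _ = 0) ?sqrtr0 //.
  apply: big1 => x /eqP rx; have := down_up_cochain0 fi rx.
  by move: (down_op _) => g gE; rewrite !ffunE gE; ring.
have := H i (introT andP (conj ip id)) f fi; congr (_ <= _); congr cnorm.
move: (down_op (up_op f)) (up_op (down_op f)) => u v.
by apply/ffunP => x; rewrite !ffunE.
Qed.

(** This is delta^m_(m-l) for [l <= m]; the empty product at [l = m.+1] agrees with the convention
    for negative indices. *)
Definition dprod l m : R := \prod_(l <= q < m.+1) delta q.

Lemma dprod01 l m : (m < d)%N -> 0 <= dprod l m <= 1.
Proof.
move=> md; rewrite /dprod big_nat_cond.
elim/big_rec: _ => [|q a]; first by rewrite ler01 lexx.
move=> /andP[/andP[_ qm] _] /andP[a0 a1].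
have /andP[q0 q1] : 0 <= delta q <= 1 by apply: delta01; lia.
by rewrite mulr_ge0 // mulr_ile1.
Qed.

(* Commuting D past a power of U; the main terms follow the recursion of
   1 - delta_m p = (1 - delta_m) + delta_m (1 - p). *)
Lemma down_up_ki_approx m i g : (i <= m)%N -> (m < d)%N -> cochain i g ->
  cnorm m (down_op (up_ki m.+1 i g) - scalef (1 - dprod i m) (up_ki m i g)
    - scalef (dprod i m) (up_ki m i (up_op (down_op g))))
  <= (m.+1 - i)%:R * gamma * cnorm i g.
Proof.
move=> im md gi; rewrite -(subnKC im) in md *; elim: (m - i)%N md => [|n IH] md.
  rewrite addn0 in md *; rewrite up_kiS // !up_kinn /dprod big_nat1 subSnn mul1r.
  exact: down_up_approx.
rewrite addnS in md *; set mm := (i + n)%N in IH md *.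
have imm : (i <= mm)%N by apply: leq_addr.
have mmd := ltnW md.
set F := up_ki mm.+1 i g; set p := dprod i mm.
have pE : dprod i mm.+1 = p * delta mm.+1.
  by rewrite /dprod big_nat_recr //= leqW.
have FE : up_ki mm.+2 i g = up_op F by rewrite up_kiS // leqW.
set u := up_op (down_op g).
pose e2 := down_op F - scalef (1 - p) (up_ki mm i g) - scalef p (up_ki mm i u).
pose e1 := down_op (up_op F) - scalef (1 - delta mm.+1) F
            - scalef (delta mm.+1) (up_op (down_op F)).
have -> : down_op (up_ki mm.+2 i g) - scalef (1 - dprod i mm.+1) F
   - scalef (dprod i mm.+1) (up_ki mm.+1 i u) = e1 + scalef (delta mm.+1) (up_op e2).
  rewrite FE pE /e1 /e2 !raddfB /= !up_scalef -(up_kiS g imm) -(up_kiS u imm) -/F.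
  move: (down_op (up_op F)) (up_op (down_op F)) (up_ki _ _ u) (F) => A B C D.
  by apply/ffunP => x; rewrite !ffunE; ring.
have Fc : cochain mm.+1 F by apply: cochain_up_ki => //; apply: leqW.
have n1 : cnorm mm.+1 e1 <= gamma * cnorm i g.
  apply: le_trans (down_up_approx md Fc) _.
  by rewrite ler_wpM2l ?gamma_ge0 // cnorm_up_ki // ?leqW // ltnW.
have n2 : cnorm mm e2 <= (mm.+1 - i)%:R * gamma * cnorm i g by apply: IH.
apply: le_trans (cnormD _ _ _) _.
have -> : (mm.+2 - i = (mm.+1 - i).+1)%N by rewrite subSn // leqW.
rewrite -natr1 !mulrDl mul1r addrC lerD // cnormZ.
have /andP[d0 d1] := delta01 md; rewrite ger0_norm //.
apply: le_trans n2; apply: le_trans (cnorm_up Dwd _ mmd).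
by rewrite ler_piMl ?cnorm_ge0.
Qed.

Lemma H_space_down i g : H_space i g -> down_op g = 0.
Proof.
case=> gi gD; case: (posnP i) => [i0|/gD //].
by apply: down_cochain0; rewrite -i0.
Qed.

Lemma down_H_approx m i g : (i <= m)%N -> (m < d)%N -> H_space i g ->
  cnorm m (down_op (up_ki m.+1 i g) - scalef (1 - dprod i m) (up_ki m i g))
  <= (m.+1 - i)%:R * gamma * cnorm i g.
Proof.
move=> im md Hg; have [gi _] := Hg; have := down_up_ki_approx im md gi.
by rewrite (H_space_down Hg) (raddf0 (@up_op R P)) (raddf0 (up_ki m i)) (raddf0 (scalef _)) subr0.
Qed.

(** For g in H^i, applying D to U^(m+1)_i g gives nearly [1 - dprod i m] times U^m_i g; these are
    the factors met on the descent from rank [k] to rank [j]. *)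
Definition kappa k j i : R := \prod_(j <= m < k) (1 - dprod i m).

Lemma kappa01 k j i : (k <= d)%N -> 0 <= kappa k j i <= 1.
Proof.
move=> kd; rewrite /kappa big_nat_cond; elim/big_rec: _ => [|q a].
  by rewrite ler01 lexx.
move=> /andP[/andP[_ qm] _] /andP[a0 a1].
have /andP[q0 q1] : 0 <= dprod i q <= 1 by apply: dprod01; lia.
by rewrite mulr_ge0 ?mulr_ile1 ?subr_ge0 // lerBlDr lerDl.
Qed.

Lemma cnorm_down_ki k j f : (j <= k)%N -> (k <= d)%N -> cnorm j (down_ki k j f) <= cnorm k f.
Proof.
move=> jk; rewrite -(subnKC jk); elim: (k - j)%N f => [|n IH] f kd.
  by rewrite addn0 down_kinn.
rewrite addnS in kd *.
rewrite down_kiS ?leq_addr // (le_trans (IH _ (ltnW kd))) //.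
exact: cnorm_down.
Qed.

(** Each of the k - j descents errs by at most k gamma |g|, and neither the later contractions nor
    the factors, which are at most 1, amplify the error. *)
Lemma down_ki_H_approx k j i g : (i <= j <= k)%N -> (k <= d)%N -> H_space i g ->
  cnorm j (down_ki k j (up_ki k i g) - scalef (kappa k j i) (up_ki j i g))
  <= ((k - j) * k)%:R * gamma * cnorm i g.
Proof.
move=> /andP[ij jk] kd Hg; rewrite -(subnKC jk) in kd *.
elim: (k - j)%N kd => [|n IH] kd.
  rewrite addn0 down_kinn /kappa big_geq // scalef1 subrr cnorm0.
  by rewrite subnn mul0n !mul0r.
rewrite addnS in kd *; set m := (j + n)%N in IH kd *.
have jm : (j <= m)%N by apply: leq_addr.
have im := leq_trans ij jm.
rewrite down_kiS //.
pose e := down_op (up_ki m.+1 i g) - scalef (1 - dprod i m) (up_ki m i g).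
pose e' := down_ki m j (up_ki m i g) - scalef (kappa m j i) (up_ki j i g).
have -> : down_ki m j (down_op (up_ki m.+1 i g))
      - scalef (kappa m.+1 j i) (up_ki j i g)
   = down_ki m j e + scalef (1 - dprod i m) e'.
  rewrite /e raddfB /= down_ki_scalef /e' /kappa big_nat_recr //=.
  move: (down_ki m j (down_op _)) (down_ki m j (up_ki _ _ _)) (up_ki j i g) => A B C.
  by apply/ffunP => x; rewrite !ffunE; ring.
apply: le_trans (cnormD _ _ _) _.
have n1 : cnorm j (down_ki m j e) <= (m.+1 - i)%:R * gamma * cnorm i g.
  apply: le_trans (cnorm_down_ki _ jm (ltnW kd)) _; exact: down_H_approx.
have n2 := IH (ltnW kd); rewrite -/e' in n2.
have gg : 0 <= gamma * cnorm i g by rewrite mulr_ge0 ?gamma_ge0 ?cnorm_ge0.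
apply: (@le_trans _ _ ((m.+1 - i)%:R * gamma * cnorm i g
    + ((m - j) * m)%:R * gamma * cnorm i g)).
  apply: lerD => //; rewrite cnormZ.
  have /andP[q0 q1] := dprod01 i kd.
  rewrite ger0_norm ?subr_ge0 //; apply: le_trans n2.
  by rewrite ler_piMl ?cnorm_ge0 // lerBlDr lerDl.
rewrite -!mulrA -mulrDl -natrD ler_wpM2r // ler_nat.
nia.
Qed.

Lemma up_op_const_le a y : 0 <= a -> up_op (constf P a) y <= a.
Proof.
move=> a0; case ry : (rk y) => [|n]; last by rewrite (up_constf Dwd _ ry).
by rewrite ffunE big_pred0 ?mulr0 // => x; rewrite /below ry andbF.
Qed.

Lemma down_op_const_le a y : 0 <= a -> down_op (constf P a) y <= a.
Proof.
move=> a0; have [lt|ge] := ltnP (rk y) d; first by rewrite down_constf.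
rewrite ffunE big_pred0 ?mul0r // => x; apply/negP => /andP[_ /eqP rx].
by have := rk_le_dim x; rewrite rx ltnNge ge.
Qed.

(** A sup-norm bound on the whole poset, stable under U and D: they are averages, except that U
    gives 0 at rank 0 and D gives 0 at rank d. *)
Definition bounded a f := forall x, 0 <= f x <= a.

Lemma bounded_up a f : 0 <= a -> bounded a f -> bounded a (up_op f).
Proof.
move=> a0 fa x; apply/andP; split.
  by apply: up_op_ge0 => y; case/andP: (fa y).
apply: le_trans (up_op_const_le x a0).
by apply: up_op_mono => y; rewrite [leRHS]ffunE; case/andP: (fa y).
Qed.

Lemma bounded_down a f : 0 <= a -> bounded a f -> bounded a (down_op f).
Proof.
move=> a0 fa x; apply/andP; split.
  by apply: down_op_ge0 => y; case/andP: (fa y).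
apply: le_trans (down_op_const_le x a0).
by apply: down_op_mono => y; rewrite [leRHS]ffunE; case/andP: (fa y).
Qed.

Lemma bounded_up_ki a k i f : 0 <= a -> bounded a f -> bounded a (up_ki k i f).
Proof.
move=> a0 fa; rewrite /up_ki; elim: (k - i)%N => //= n IH.
exact: bounded_up.
Qed.

Lemma bounded_down_ki a k i f : 0 <= a -> bounded a f -> bounded a (down_ki k i f).
Proof.
move=> a0 fa; rewrite /down_ki; elim: (k - i)%N => //= n IH.
exact: bounded_down.
Qed.

Lemma bounded_indic S : bounded 1 (indic S : {ffun P -> R}).
Proof. by move=> x; rewrite ffunE; case: (x \in S); rewrite ?lexx ?ler01. Qed.

(* Non-laziness also bounds the walk between distinct elements: the common
   lower covers of s and t are lower covers of s. *)
Lemma bounded_up_down s : bounded gamma (up_op (down_op (indic [set s]))).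
Proof.
move=> t; have b1 := bounded_down ler01 (bounded_indic [set s]).
have /andP[-> _] := bounded_up ler01 b1 t; rewrite /=.
case: (posnP (rk s)) => [s0|sp].
  by rewrite (down_cochain0 (f := indic [set s])) ?raddf0 ?ffunE ?gamma_ge0 // -s0;
    apply: indic_cochain.
have [rt|rt] := eqVneq (rk t) (rk s); last first.
  have := cochain_up (cochain_down (@indic_cochain s)); rewrite prednK // => -> //.
  exact: gamma_ge0.
apply: le_trans (Pnl sp); rewrite /transition /=.
move: b1; set h := down_op _ => b1.
have h0 x : ~~ below x s -> h x = 0.
  move=> xs; rewrite ffunE big1 ?mul0r // => y xy; rewrite ffunE inE.
  case: eqP => [E|_]; last by rewrite mulr0.
  by rewrite E (negPf xs) in xy.
rewrite !ffunE rt ler_wpM2l ?invr_ge0 //.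
rewrite (bigID (fun x => below x s)) /= [X in _ + X]big1 ?addr0; last first.
  by move=> x /andP[_]; apply: h0.
rewrite [leRHS](bigID (fun x => below x t)) /= -[leLHS]addr0 lerD //.
  by rewrite le_eqVlt; apply/orP; left; apply/eqP; apply: eq_bigl => x; apply: andbC.
by apply: sumr_ge0 => x _; case/andP: (b1 x).
Qed.

(** Two kinds of error are needed. [e], from commutation, is small in norm relative to 1_s. [h],
    from the walk U D, is controlled pointwise by non-laziness; its norm may be large compared with
    that of 1_s, but pairing with 1_s reads it only at [s]. *)
Lemma up_down_indic k s : (rk s <= k)%N -> (k <= d)%N ->
  exists h e, [/\ bounded ((k - rk s)%:R * gamma) h,
    cnorm (rk s) e <= ((k - rk s) * k)%:R * gamma * cnorm (rk s) (indic [set s]) &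
    down_ki k (rk s) (up_ki k (rk s) (indic [set s]))
     = scalef (kappa k (rk s) (rk s)) (indic [set s]) + h + e].
Proof.
set i := rk s; set g := indic [set s].
move=> ik kd; rewrite -(subnKC ik) in kd *.
elim: (k - i)%N kd => [|n IH] kd.
  exists 0, 0; rewrite addn0 subnn mul0n !mul0r cnorm0 /kappa big_geq // scalef1 !addr0.
  split => //; first by move=> x; rewrite ffunE lexx.
  by rewrite up_kinn down_kinn.
rewrite addnS in kd *; set m := (i + n)%N in IH kd *.
have im : (i <= m)%N by apply: leq_addr.
have [h [e [hb ne hE]]] := IH (ltnW kd).
set u := up_op (down_op g).
set p := dprod i m; have /andP[p0 p1] := dprod01 i kd.
pose e' := down_op (up_ki m.+1 i g) - scalef (1 - p) (up_ki m i g)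
    - scalef p (up_ki m i u).
pose v := down_ki m i (up_ki m i u).
have vb : bounded gamma v.
  by apply: bounded_down_ki gamma_ge0 _; apply: bounded_up_ki gamma_ge0 _;
    apply: bounded_up_down.
exists (scalef (1 - p) h + scalef p v), (scalef (1 - p) e + down_ki m i e'); split.
- move=> x; have /andP[h0 h1] := hb x; have /andP[v0 v1] := vb x.
  rewrite !ffunE addr_ge0 ?mulr_ge0 ?subr_ge0 //=.
  rewrite subSn // -natr1 [leRHS]mulrDl [1 * gamma]mul1r lerD //.
    by apply: le_trans h1; rewrite ler_piMl // lerBlDr lerDl.
  by apply: le_trans v1; rewrite ler_piMl.
- apply: le_trans (cnormD _ _ _) _.
  have n1 : cnorm i (down_ki m i e') <= (m.+1 - i)%:R * gamma * cnorm i g.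
    apply: le_trans (cnorm_down_ki _ im (ltnW kd)) _.
    by apply: down_up_ki_approx => //; apply: indic_cochain.
  have gg : 0 <= gamma * cnorm i g by rewrite mulr_ge0 ?gamma_ge0 ?cnorm_ge0.
  apply: (@le_trans _ _ (((m - i) * m)%:R * gamma * cnorm i g
      + (m.+1 - i)%:R * gamma * cnorm i g)).
    apply: lerD => //; rewrite cnormZ.
    rewrite ger0_norm ?subr_ge0 //; apply: le_trans ne.
    by rewrite ler_piMl ?cnorm_ge0 // lerBlDr lerDl.
  rewrite -!mulrA -mulrDl -natrD ler_wpM2r // ler_nat.
  nia.
- rewrite down_kiS //.
  have -> : down_op (up_ki m.+1 i g)
     = e' + scalef (1 - p) (up_ki m i g) + scalef p (up_ki m i u).
    by rewrite /e' addrAC subrK subrK.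
  rewrite !raddfD /= !down_ki_scalef hE /kappa big_nat_recr //= -/p -/v -/g.
  move: (down_ki m i e') (v) (g) => A B C.
  by apply/ffunP => x; rewrite !ffunE; ring.
Qed.

Lemma up_ki_local k i f y : (i <= k)%N -> rk y = k -> (forall x, (x <= y)%O -> f x = 0) ->
  up_ki k i f y = 0.
Proof.
move=> ik; rewrite -(subnKC ik); elim: (k - i)%N y => [|n IH] y.
  by rewrite addn0 up_kinn => _; apply.
rewrite addnS => ry f0; rewrite up_kiS ?leq_addr // ffunE big1 ?mulr0 // => x.
move=> /andP[xy /eqP rx]; apply: IH; first by move: rx; rewrite ry => -[].
by move=> z zx; apply: f0; apply: le_trans (ltW xy).
Qed.

Lemma up_ki_constf k i a y : (i <= k)%N -> rk y = k -> up_ki k i (constf P a) y = a.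
Proof.
move=> ik; rewrite -(subnKC ik); elim: (k - i)%N y => [|n IH] y.
  by rewrite addn0 up_kinn ffunE.
rewrite addnS => ry; rewrite up_kiS ?leq_addr //.
rewrite -[RHS](up_constf Dwd a ry) !ffunE; congr (_ * _); apply: eq_bigr => x.
by move=> /andP[_]; rewrite ry => /eqP[rx]; rewrite IH ?ffunE.
Qed.

Lemma up_ki_eq k i f f' y : (i <= k)%N -> rk y = k ->
  (forall x, rk x = i -> f x = f' x) -> up_ki k i f y = up_ki k i f' y.
Proof.
move=> ik; rewrite -(subnKC ik); elim: (k - i)%N y => [|n IH] y.
  by rewrite addn0 !up_kinn => ry; apply.
rewrite addnS => ry ff; rewrite !up_kiS ?leq_addr // !ffunE.
congr (_ * _); apply: eq_bigr => x.
by move=> /andP[_]; rewrite ry => /eqP[rx]; rewrite IH.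
Qed.

Lemma sum_sqr_le (I : finType) (Q : pred I) (F : I -> R) :
  (\sum_(t | Q t) F t) ^+ 2 <= #|Q|%:R * \sum_(t | Q t) F t ^+ 2.
Proof.
have [c0|c0] := posnP #|Q|.
  rewrite c0 mul0r big_pred0 ?expr0n // => t.
  by have /eqP := c0; rewrite -leqn0 leqNgt => /card_gt0P h; apply/negP => Qt; apply: h; exists t.
set n := #|Q| in c0 *; set s := \sum_(t | Q t) F t.
have np : (0 : R) < n%:R by rewrite ltr0n.
have : 0 <= \sum_(t | Q t) (F t - s / n%:R) ^+ 2.
  by apply: sumr_ge0 => t _; apply: sqr_ge0.
rewrite (eq_bigr (fun t => F t ^+ 2 + ((s / n%:R) ^+ 2 - (2 * (s / n%:R)) * F t))); last first.
  by move=> t _; ring.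
rewrite big_split sumrB /= sumr_const -mulr_sumr -/s -/n -[_ ^+ 2 *+ n]mulr_natl => h.
rewrite -subr_ge0; suff -> : n%:R * \sum_(t | Q t) F t ^+ 2 - s ^+ 2 =
  n%:R * (\sum_(t | Q t) F t ^+ 2 + (n%:R * (s / n%:R) ^+ 2 - 2 * (s / n%:R) * s)).
  by rewrite mulr_ge0 // ltW.
by field; rewrite gt_eqF.
Qed.

(* Summing |U^k_i 1_s|^2 over s in X(i): from below by Cauchy-Schwarz, each
   y in X(k) having R(k,i) descendants; from above by the expansion of
   D^k_i U^k_i 1_s. *)
Lemma kappa_ge k i : (i <= k)%N -> (k <= d)%N ->
  (reg P k i)%:R^-1 <= kappa k i i + 2 * (k ^ 2)%:R * gamma.
Proof.
move=> ik kd.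
have up (s : P) : rk s = i -> inner k (up_ki k i (indic [set s])) (up_ki k i (indic [set s]))
   <= (kappa k i i + 2 * (k ^ 2)%:R * gamma) * piw s.
  move=> rs; rewrite inner_up_ki //.
  have [|h [e [hb ne hE]]] := @up_down_indic k s _ kd; first by rewrite rs.
  rewrite -rs hE innerC !innerDl innerZl !inner_indic.
  have -> : indic [set s] s = 1 by rewrite ffunE inE eqxx.
  have ps := piw_ge0 s.
  have /andP[_ h1] := hb s.
  have := le_trans (ler_norm _) (cauchy_schwarz (rk s) e (indic [set s])).
  rewrite inner_indic.
  have n1 : cnorm (rk s) (indic [set s]) ^+ 2 = piw s.
    by rewrite cnorm_sqr inner_indic ffunE inE eqxx mulr1.
  have : cnorm (rk s) e * cnorm (rk s) (indic [set s])
     <= ((k - rk s) * k)%:R * gamma * piw s.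
    by rewrite -n1 expr2 mulrA ler_wpM2r ?cnorm_ge0.
  have : piw s * h s <= piw s * ((k - rk s)%:R * gamma) by rewrite ler_wpM2l.
  have : ((k - rk s)%:R + ((k - rk s) * k)%:R) * (gamma * piw s)
      <= 2 * (k ^ 2)%:R * (gamma * piw s).
    rewrite ler_wpM2r ?mulr_ge0 ?gamma_ge0 // -natrD -natrM ler_nat.
    by nia.
  move: ((k - rk s)%:R : R) (((k - rk s) * k)%:R : R) ((k ^ 2)%:R : R) => A B C.
  by lra.
have low (y : P) : rk y = k -> (reg P k i)%:R^-1 <=
    \sum_(s : P | rk s == i) up_ki k i (indic [set s]) y ^+ 2.
  move=> ry; pose Q := [pred s : P | (rk s == i) && (s <= y)%O].
  have cQ : #|Q| = reg P k i by rewrite -(regP ik ry) cardsE.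
  have E : \sum_(s | Q s) up_ki k i (indic [set s]) y = 1.
    rewrite -[RHS](up_ki_constf 1 ik ry) -sum_ffunE -raddf_sum /=.
    apply/eqP; rewrite -subr_eq0; apply/eqP.
    transitivity (up_ki k i (\sum_(s | Q s) indic [set s] - constf P 1) y).
      by rewrite raddfB !ffunE.
    (* [q] agrees on X(i) with the difference of the two functions and vanishes below [y], so U^k_i
       maps it to 0 at [y]. *)
    pose q : {ffun P -> R} := [ffun x => - ((rk x == i) && ~~ (x <= y)%O)%:R].
    rewrite (@up_ki_eq k i _ q) //.
      by apply: up_ki_local => // x xy; rewrite ffunE xy andbF oppr0.
    move=> x rx; rewrite !ffunE sum_ffunE rx eqxx /=.
    have [xy|xy] := boolP (x <= y)%O.
      rewrite (bigD1 x) /=; last by rewrite rx eqxx xy.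
      rewrite big1 ?ffunE ?inE ?eqxx ?addr0 ?subrr ?oppr0 // => t /andP[_ tx].
      by rewrite ffunE inE eq_sym (negPf tx).
    rewrite big1 ?sub0r // => t /andP[_ ty]; rewrite ffunE inE.
    by case: eqP => // xt; rewrite xt ty in xy.
  have := sum_sqr_le Q (fun s => up_ki k i (indic [set s]) y).
  have rp : (0 : R) < (reg P k i)%:R by rewrite ltr0n (reg_gt0 Dwd).
  rewrite E cQ expr1n -ler_pdivrMl // mulr1 => /le_trans; apply.
  rewrite [leRHS](bigID (fun s => (s <= y)%O)) /= lerDl.
  by apply: sumr_ge0 => s _; apply: sqr_ge0.
have : \sum_(s : P | rk s == i) inner k (up_ki k i (indic [set s])) (up_ki k i (indic [set s]))
   <= \sum_(s : P | rk s == i) (kappa k i i + 2 * (k ^ 2)%:R * gamma) * piw s.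
  by apply: ler_sum => s /eqP; apply: up.
rewrite -mulr_sumr sum_piw ?(leq_trans ik) // mulr1; apply: le_trans.
rewrite /inner exchange_big /=.
apply: (@le_trans _ _ (\sum_(y : P | rk y == k) piw y * (reg P k i)%:R^-1)).
  by rewrite -mulr_suml sum_piw // mul1r.
apply: ler_sum => y /eqP ry; rewrite (eq_bigr (fun s =>
   piw y * up_ki k i (indic [set s]) y ^+ 2)); last by move=> s _; ring.
by rewrite -mulr_sumr ler_wpM2l ?piw_ge0 // low.
Qed.

End EposetCalculus.


(** * Approximate eigenvalues of pure walks and HD-walks *)

Section WalkSpectrum.
Variables (R : realType) (P : measured_poset R).
Variables (delta : nat -> R) (gamma : R).
Hypothesis Dwd : D_well_defined P.
Hypothesis Pep : eposet P delta gamma.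
Hypothesis Pnl : non_lazy P gamma.
Local Notation d := (poset_dim P).
Hypothesis d_gt0 : (0 < d)%N.
Implicit Types (f g h : {ffun P -> R}) (x y : P) (a b : R) (i j k l m : nat).
Implicit Types (Y : seq bool) (alpha : {fsfun seq bool -> R with 0}).

(* lambda_walk as a recursion along the walk, m being the current rank. *)
Fixpoint walk_eigenvalue l m Y : R :=
  match Y with
  | [::] => 1
  | true :: Y' => walk_eigenvalue l m.+1 Y'
  | false :: Y' =>
      (1 - delta_prod delta m.-1 (m.-1%:Z - l%:Z)) * walk_eigenvalue l m.-1 Y'
  end.

Lemma down_positions_cons (b : bool) Y : down_positions (b :: Y) =
  (if b then [::] else [:: 1%N]) ++ [seq p.+1 | p <- down_positions Y].
Proof.
rewrite /down_positions /= -(addn1 1%N) iotaDl filter_map.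
have -> : [seq p <- iota 1 (size Y) | preim (addn 1%N) (fun p => ~~ nth true (b :: Y) p.-1) p]
   = [seq p <- iota 1 (size Y) | ~~ nth true Y p.-1].
  by apply: eq_in_filter => p; rewrite mem_iota => /andP[p0 _]; case: p p0.
by case: b.
Qed.

Lemma size_down_positions Y : size (down_positions Y) = height Y.
Proof.
elim: Y => [//|b Y IH].
by rewrite down_positions_cons size_cat size_map IH /height; case: b.
Qed.

Lemma down_position_ge Y s : (s < height Y)%N -> (s < nth 0%N (down_positions Y) s)%N.
Proof.
elim: Y s => [//|b Y IH] s; rewrite down_positions_cons.
case: b => /=; rewrite /height /= ?add0n ?add1n => sY.
  rewrite (nth_map 0%N) ?size_down_positions // ltnS ltnW //; exact: IH.
case: s sY => [//|s] /= sY.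
by rewrite (nth_map 0%N) ?size_down_positions // ltnS; apply: IH.
Qed.

Lemma lambda_walkE m l Y : stays_in_poset P m Y ->
  lambda_walk delta m l Y = walk_eigenvalue l m Y.
Proof.
rewrite /lambda_walk big_add1 /= big_mkord.
elim: Y m => [|b Y IH] m; first by rewrite big_ord0.
case: b => /= /andP[m0 /IH <-]; rewrite /height /= ?add0n ?add1n.
  apply: eq_bigr => s _; have sY : (s < height Y)%N by [].
  rewrite down_positions_cons /= (nth_map 0%N) ?size_down_positions //.
  by rewrite !addnS !addSn.
rewrite down_positions_cons big_ord_recl /=; congr (_ * _).
  by rewrite muln1 addn1 subn2.
apply: eq_bigr => s _; have sY : (s < height Y)%N by [].
rewrite /bump /= (nth_map 0%N) ?size_down_positions //.
have := down_position_ge sY; move: (nth _ _ _) => q sq.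
have -> : (m + q.+1 - 2 * (1 + s).+1 = m.-1 + q - 2 * s.+1)%N by lia.
by [].
Qed.

Lemma delta_prod01 l m : (m < d)%N -> 0 <= delta_prod delta m (m%:Z - l%:Z) <= 1.
Proof.
move=> md; case E : (m%:Z - l%:Z) => [n|n] /=; last by rewrite ler01 lexx.
exact: (dprod01 Pep d_gt0).
Qed.

Lemma delta_prodE l m : (l <= m)%N -> delta_prod delta m (m%:Z - l%:Z) = dprod delta l m.
Proof. by move=> lm; rewrite subzn //= subKn. Qed.

Lemma walk_eigenvalue01 l m Y : (m <= d)%N -> stays_in_poset P m Y ->
  0 <= walk_eigenvalue l m Y <= 1.
Proof.
elim: Y m => [|[] Y IH] m md /=; first by rewrite ler01 lexx.
  by move=> /andP[lt]; apply: IH.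
move=> /andP[m0 /IH]; rewrite (leq_trans (leq_pred _)) // => /(_ isT) /andP[a0 a1].
have /andP[b0 b1] : 0 <= delta_prod delta m.-1 (m.-1%:Z - l%:Z) <= 1.
  by apply: delta_prod01; lia.
by rewrite mulr_ge0 ?mulr_ile1 ?subr_ge0 // lerBlDr lerDl.
Qed.

Definition final_rank m Y : nat := (m + count_mem true Y - count_mem false Y)%N.

Lemma stays_in_poset_count m Y : stays_in_poset P m Y ->
  (count_mem false Y <= m + count_mem true Y)%N.
Proof.
elim: Y m => [//|[] Y IH] m /= /andP[m0 /IH];
  move: (count_mem true Y) (count_mem false Y) => A B; lia.
Qed.

Lemma cochain_walk m Y f : stays_in_poset P m Y -> cochain m f ->
  cochain (final_rank m Y) (walk_op Y f).
Proof.
rewrite /final_rank; elim: Y m f => [|[] Y IH] m f /=.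
- by rewrite addn0 subn0.
- move=> /andP[_ sY] fm; have := IH _ _ sY (cochain_up fm).
  by rewrite add0n add1n addnS addSn.
- move=> /andP[m0 sY] fm; have := IH _ _ sY (cochain_down fm).
  rewrite add0n add1n; congr cochain.
  have := stays_in_poset_count sY.
  by move: (count_mem true Y) (count_mem false Y) => A B; lia.
Qed.

Lemma cnorm_walk m Y f : (m <= d)%N -> stays_in_poset P m Y ->
  cnorm (final_rank m Y) (walk_op Y f) <= cnorm m f.
Proof.
rewrite /final_rank; elim: Y m f => [|[] Y IH] m f md /=.
- by rewrite addn0 subn0.
- move=> /andP[lt sY]; apply: le_trans (cnorm_up Dwd f lt).
  by have := IH _ (up_op f) lt sY; rewrite add0n add1n addnS addSn.
- move=> /andP[m0 sY]; have md' : (m.-1 < d)%N by lia.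
  have := cnorm_down Dwd f md'; rewrite prednK //; apply: le_trans.
  have := IH _ (down_op f) (ltnW md') sY; rewrite add0n add1n; congr (_ <= _); congr cnorm.
  have := stays_in_poset_count sY.
  by move: (count_mem true Y) (count_mem false Y) => A B; lia.
Qed.

(** A step U just lengthens the power of U applied to [g]. A step D errs by at most L gamma |g|, [L]
    bounding all ranks reached, and the remaining steps are contractions. *)
Lemma walk_approx l g L m Y : (l <= m <= d)%N -> stays_in_poset P m Y ->
  (m + count_mem true Y <= L)%N -> H_space l g ->
  cnorm (final_rank m Y) (walk_op Y (up_ki m l g)
     - scalef (walk_eigenvalue l m Y) (up_ki (final_rank m Y) l g))
  <= (height Y * L)%:R * gamma * cnorm l g.
Proof.
move=> + + + Hg.
have g0 := gamma_ge0 Dwd Pnl d_gt0.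
have gg : 0 <= gamma * cnorm l g by rewrite mulr_ge0 ?cnorm_ge0.
elim: Y m => [|[] Y IH] m /andP[lm md].
- by rewrite /final_rank /= addn0 subn0 scalef1 subrr cnorm0 mul0n !mul0r.
- move=> /= /andP[lt sY]; rewrite add1n addnS => mL.
  have := IH m.+1; rewrite leqW //= lt sY => /(_ isT isT mL).
  rewrite up_kiS // /height /= add0n.
  by rewrite (_ : final_rank m.+1 Y = final_rank m (true :: Y)) // /final_rank /= addnS addSn.
- move=> /= /andP[m0 sY]; rewrite add0n => mL.
  case: m m0 lm md sY mL => [//|m] _ lm md /= sY mL.
  have fE : final_rank m.+1 (false :: Y) = final_rank m Y.
    by rewrite /final_rank /= add0n add1n addSn subSS.
  rewrite fE; move: lm; rewrite leq_eqVlt => /orP[/eqP lE|]; last rewrite ltnS => lm.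
    rewrite lE up_kinn (H_space_down Hg) (raddf0 (walk_op Y)).
    (* The walk leaves rank l downwards and D kills [g]; accordingly the index is -1, where
       delta^m_t = 1 and the factor of the eigenvalue is 0. *)
    have -> : delta_prod delta m (m%:Z - m.+1%:Z) = 1.
      by rewrite (_ : m%:Z - m.+1%:Z = Negz 0) //; lia.
    rewrite subrr mul0r scale0f subrr cnorm0.
    by rewrite -mulrA mulr_ge0 // ?ler0n // mulr_ge0 ?cnorm_ge0.
  rewrite delta_prodE //.
  pose e := down_op (up_ki m.+1 l g) - scalef (1 - dprod delta l m) (up_ki m l g).
  have ne : cnorm m e <= (m.+1 - l)%:R * gamma * cnorm l g.
    exact: (down_H_approx Dwd Pep Pnl d_gt0).
  pose e' := walk_op Y (up_ki m l g)
     - scalef (walk_eigenvalue l m Y) (up_ki (final_rank m Y) l g).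
  have -> : walk_op Y (down_op (up_ki m.+1 l g))
     - scalef ((1 - dprod delta l m) * walk_eigenvalue l m Y) (up_ki (final_rank m Y) l g)
     = walk_op Y e + scalef (1 - dprod delta l m) e'.
    rewrite /e raddfB /= walk_scalef /e'.
    by apply/ffunP => x; rewrite !ffunE; ring.
  apply: le_trans (cnormD _ _ _) _.
  have ne' : cnorm (final_rank m Y) e' <= (height Y * L)%:R * gamma * cnorm l g.
    apply: IH => //; first by rewrite lm ltnW.
    by apply: leq_trans mL; rewrite leq_add2r.
  have /andP[q0 q1] := dprod01 Pep d_gt0 l md.
  apply: (@le_trans _ _ ((m.+1 - l)%:R * gamma * cnorm l g
     + (height Y * L)%:R * gamma * cnorm l g)).
    apply: lerD; first by apply: le_trans ne; apply: cnorm_walk => //; apply: ltnW.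
    rewrite cnormZ ger0_norm ?subr_ge0 //; apply: le_trans ne'.
    by rewrite ler_piMl ?cnorm_ge0 // lerBlDr lerDl.
  rewrite -!mulrA -mulrDl -natrD ler_wpM2r // ler_nat /height /= add1n mulSn.
  rewrite leq_add2r; apply: leq_trans (leq_subr _ _) (leq_trans _ mL).
  exact: leq_addr.
Qed.

Section HDWalk.
Variables (k : nat) (alpha : {fsfun seq bool -> R with 0}).
Hypothesis kd : (k < d)%N.
Hypothesis walk_alpha : hd_walk P k alpha.
Local Notation M := (hd_op P alpha).

Lemma pure_walk_final_rank Y : pure_walk P k Y -> final_rank k Y = k.
Proof. by rewrite /pure_walk /final_rank => /andP[/eqP -> _]; rewrite addnK. Qed.

Lemma cochain_hd f : cochain k f -> cochain k (M f).
Proof.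
case: walk_alpha => pw _ _ _ fk; rewrite hd_opE big_seq.
apply: cochain_sum => Y /pw pY; apply: cochainZ.
rewrite -{1}(pure_walk_final_rank pY); apply: cochain_walk => //.
by case/andP: pY.
Qed.

Lemma height_le Y : Y \in finsupp alpha -> (height Y <= hd_height alpha)%N.
Proof. by move=> Ya; rewrite /hd_height (big_rem _ Ya) leq_maxl. Qed.

Lemma hd_weight_ge1 : 1 <= hd_weight alpha.
Proof.
case: walk_alpha => _ s1 _ _; rewrite -s1 /hd_weight.
by apply: ler_sum => Y _; apply: ler_norm.
Qed.

Lemma hd_lambda_norm j : `|hd_lambda delta k j alpha| <= hd_weight alpha.
Proof.
case: walk_alpha => pw _ _ _.
apply: le_trans (ler_norm_sum _ _ _) _; rewrite /hd_weight !big_seq.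
apply: ler_sum => Y /pw /andP[_ pY]; rewrite normrM ler_piMr //.
rewrite lambda_walkE //.
by have /andP[a0 a1] := walk_eigenvalue01 j (ltnW kd) pY; rewrite ger0_norm.
Qed.

(** At l = 0 every product delta^m_m contains delta_0 = 0, so all factors are 1. *)
Lemma hd_lambda0 : hd_lambda delta k 0 alpha = 1.
Proof.
case: walk_alpha => pw <- _ _; rewrite /hd_lambda !big_seq.
apply: eq_bigr => Y /pw /andP[_ pY]; rewrite lambda_walkE //.
rewrite -[RHS]mulr1; congr (_ * _).
elim: Y (k) pY => [//|[] Y IH] m /= /andP[m0 sY]; first exact: IH.
rewrite IH // addn0 subnn mulr1 big_ltn //.
by case: Pep => -> _ _ _; rewrite mul0r subr0.
Qed.

Lemma hd_lambda_height0 j : hd_height alpha = 0%N -> hd_lambda delta k j alpha = 1.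
Proof.
case: walk_alpha => pw <- _ _ h0; rewrite /hd_lambda !big_seq.
apply: eq_bigr => Y Ya; have := height_le Ya; rewrite h0 leqn0 => /eqP hY.
by rewrite /lambda_walk hY big_geq // mulr1.
Qed.

Lemma hd_approx j g : (j <= k)%N -> H_space j g ->
  cnorm k (M (up_ki k j g) - scalef (hd_lambda delta k j alpha) (up_ki k j g))
  <= hd_weight alpha * (hd_height alpha * (hd_height alpha + k))%:R * gamma * cnorm j g.
Proof.
move=> jk Hg; case: walk_alpha => pw _ _ _.
have g0 := gamma_ge0 Dwd Pnl d_gt0.
have gg : 0 <= gamma * cnorm j g by rewrite mulr_ge0 ?cnorm_ge0.
have -> : M (up_ki k j g) - scalef (hd_lambda delta k j alpha) (up_ki k j g) =
  \sum_(Y <- finsupp alpha) scalef (alpha Y) (walk_op Y (up_ki k j g)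
      - scalef (lambda_walk delta k j Y) (up_ki k j g)).
  rewrite hd_opE /hd_lambda; apply/ffunP => x; rewrite !ffunE !sum_ffunE mulr_suml.
  by rewrite -sumrB; apply: eq_bigr => Y _; rewrite !ffunE; ring.
apply: le_trans (cnorm_sum _ _ _ _) _; rewrite /hd_weight -!mulrA mulr_suml !big_seq.
apply: ler_sum => Y Ya; have pY := pw Y Ya; have /andP[/eqP cY sY] := pY.
rewrite cnormZ ler_wpM2l // lambda_walkE //.
(* A pure walk has as many U as D, so it never climbs above rank k + h(M). *)
have := @walk_approx j g (hd_height alpha + k) k Y; rewrite jk (ltnW kd) => /(_ isT sY).
rewrite pure_walk_final_rank // => H; apply: le_trans (H _ Hg) _.
  by rewrite addnC leq_add2r cY; apply: height_le.
by rewrite -mulrA ler_wpM2r // ler_nat leq_mul2r height_le ?orbT.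
Qed.

End HDWalk.
End WalkSpectrum.


(** * Small gamma: near-orthogonality and nontriviality of the levels *)

Section SmallGamma.
Variables (R : realType) (P : measured_poset R).
Variables (delta : nat -> R) (gamma : R).
Hypothesis Dwd : D_well_defined P.
Hypothesis Pep : eposet P delta gamma.
Hypothesis Pnl : non_lazy P gamma.
Local Notation d := (poset_dim P).
Variable k : nat.
Hypothesis k_gt0 : (0 < k)%N.
Hypothesis kd : (k < d)%N.
Local Notation Rm := ((reg_max P k)%:R : R).
Hypothesis gamma_small : 16 * k%:R ^+ 3 * Rm * gamma <= 1.
Implicit Types (f g h : {ffun P -> R}) (x y : P) (a b : R) (i j l m : nat).

Let d_gt0 : (0 < d)%N := ltn_trans k_gt0 kd.
Let g0 : 0 <= gamma := gamma_ge0 Dwd Pnl d_gt0.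

Lemma reg_le_max i : (i <= k)%N -> (reg P k i)%:R <= Rm.
Proof.
move=> ik; rewrite ler_nat /reg_max.
exact: (@leq_bigmax_cond _ xpredT (fun i : 'I_k.+1 => reg P k i) (Ordinal (ik : (i < k.+1)%N))).
Qed.

Lemma reg_ge1 i : (i <= k)%N -> 1 <= (reg P k i)%:R :> R.
Proof. by move=> ik; rewrite ler1n (reg_gt0 Dwd) // ltnW. Qed.

Lemma reg_max_ge1 : 1 <= Rm.
Proof. exact: le_trans (reg_ge1 (leqnn k)) (reg_le_max (leqnn k)). Qed.

Lemma k_ge1 : 1 <= k%:R :> R. Proof. by rewrite ler1n. Qed.

Lemma gamma_small2 : 16 * k%:R ^+ 2 * Rm * gamma <= 1.
Proof.
apply: le_trans gamma_small; have := k_ge1; have := reg_max_ge1 => r1 k1.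
rewrite ler_wpM2r // ler_wpM2r ?(le_trans ler01) // ler_wpM2l //.
exact: ler_weXn2l.
Qed.

(** Replacing D^k_i U^k_i g by kappa g in the pairing with [g] loses k^2 gamma, and [kappa_ge] loses
    twice as much. *)
Lemma up_ki_H_lower i g : (i <= k)%N -> H_space i g ->
  ((reg P k i)%:R^-1 - 3 * k%:R ^+ 2 * gamma) * inner i g g
  <= inner k (up_ki k i g) (up_ki k i g).
Proof.
move=> ik Hg; have kd' := ltnW kd; rewrite inner_up_ki //.
have := @down_ki_H_approx _ _ _ _ Dwd Pep Pnl d_gt0 k i i g.
rewrite leqnn ik up_kinn => /(_ isT kd' Hg).
set e := down_ki _ _ _ - _ => ne.
have -> : down_ki k i (up_ki k i g) = e + scalef (kappa delta k i i) g.
  by rewrite /e subrK.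
rewrite innerDr innerZr.
have kp := @kappa_ge _ _ _ _ Dwd Pep Pnl d_gt0 k i ik kd'.
have := cauchy_schwarz i g e; rewrite ler_norml => /andP[cs _].
have gg := inner_ge0 i g.
have ne' : cnorm i g * cnorm i e <= k%:R ^+ 2 * gamma * inner i g g.
  rewrite -cnorm_sqr expr2 (mulrA _ (cnorm i g)) [leRHS]mulrC ler_wpM2l ?cnorm_ge0 //.
  apply: le_trans ne _; rewrite ler_wpM2r ?cnorm_ge0 // ler_wpM2r //.
  by rewrite -natrM ler_nat; nia.
have : ((reg P k i)%:R^-1 - 2 * (k ^ 2)%:R * gamma) * inner i g g
   <= kappa delta k i i * inner i g g.
  by rewrite ler_wpM2r // lerBlDr.
rewrite natrX; lra.
Qed.

(** Turns errors relative to |g| into errors relative to |U^k_i g|; smallness of gamma leaves at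
    least half of 1/R_max in the previous bound. *)
Lemma up_ki_H_norm i g : (i <= k)%N -> H_space i g ->
  inner i g g <= 2 * Rm * inner k (up_ki k i g) (up_ki k i g).
Proof.
move=> ik Hg; have := up_ki_H_lower ik Hg.
have r1 := reg_max_ge1; have rp : 0 < Rm by apply: lt_le_trans r1.
have sm : 3 * k%:R ^+ 2 * gamma <= (2 * Rm)^-1.
  rewrite -(ler_pM2r (_ : 0 < 2 * Rm)) ?mulr_gt0 // mulVf ?gt_eqF ?mulr_gt0 //.
  have := gamma_small2.
  have : 0 <= k%:R ^+ 2 * Rm * gamma by rewrite !mulr_ge0 ?exprn_ge0 // ltW.
  lra.
have ri : Rm^-1 <= (reg P k i)%:R^-1.
  have r1' := reg_ge1 ik.
  by rewrite lef_pV2 ?posrE ?reg_le_max // (lt_le_trans ltr01).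
have gg := inner_ge0 i g.
move=> H; have {}H : (2 * Rm)^-1 * inner i g g <= inner k (up_ki k i g) (up_ki k i g).
  apply: le_trans H; rewrite ler_wpM2r //.
  have : Rm^-1 = (2 * Rm)^-1 + (2 * Rm)^-1 by field; rewrite gt_eqF.
  lra.
by rewrite -ler_pdivrMl ?mulr_gt0.
Qed.

Lemma inner_up_H_orth i j g h : (i < j <= k)%N -> H_space j h ->
  inner j h (up_ki j i g) = 0.
Proof.
case: j => [//|j] /andP[ij jk] Hh; rewrite ltnS in ij.
rewrite up_kiS // innerC (inner_up Dwd); last by lia.
by rewrite (H_space_down Hh) inner0r.
Qed.

(** For i < j, moving U^k_j to the other side leaves the main term kappa <U^j_i g_i, g_j>, which is
    exactly 0 because D g_j = 0. Each norm |g| replaced by that of its image costs a factor sqrt(2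
    R_max). *)
Lemma cross_terms i j (gi gj : {ffun P -> R}) : (i <= k)%N -> (j <= k)%N -> i != j ->
  H_space i gi -> H_space j gj ->
  `|inner k (up_ki k i gi) (up_ki k j gj)|
  <= 2 * Rm * k%:R ^+ 2 * gamma
     * (cnorm k (up_ki k i gi) * cnorm k (up_ki k j gj)).
Proof.
wlog lt : i j gi gj / (i < j)%N => [wl ik jk ij Hi Hj|].
  have [lt|lt|E] := ltngtP i j; first exact: wl.
    by rewrite innerC [cnorm k _ * _]mulrC; apply: wl => //; rewrite eq_sym.
  by rewrite E eqxx in ij.
move=> ik jk _ Hi Hj; have kd' := ltnW kd.
rewrite innerC inner_up_ki //.
have := @down_ki_H_approx _ _ _ _ Dwd Pep Pnl d_gt0 k j i gi.
rewrite (ltnW lt) jk => /(_ isT kd' Hi).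
set e := down_ki _ _ _ - _ => ne.
have -> : down_ki k j (up_ki k i gi) = e + scalef (kappa delta k j i) (up_ki j i gi).
  by rewrite /e subrK.
rewrite innerDr innerZr inner_up_H_orth ?lt // mulr0 addr0.
apply: le_trans (cauchy_schwarz _ _ _) _.
have r1 := reg_max_ge1.
have ne' : cnorm j e <= k%:R ^+ 2 * gamma * cnorm i gi.
  apply: le_trans ne _; rewrite ler_wpM2r ?cnorm_ge0 // ler_wpM2r //.
  by rewrite -natrX ler_nat; nia.
apply: (@le_trans _ _ (k%:R ^+ 2 * gamma * (cnorm i gi * cnorm j gj))).
  by rewrite mulrA mulrC ler_wpM2r ?cnorm_ge0.
rewrite [leRHS](_ : _ = k%:R ^+ 2 * gamma *
   (2 * Rm * (cnorm k (up_ki k i gi) * cnorm k (up_ki k j gj)))); last by ring.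
rewrite ler_wpM2l ?mulr_ge0 ?exprn_ge0 //.
have R0 : 0 <= 2 * Rm by rewrite mulr_ge0.
rewrite -(ler_pXn2r (n := 2)) ?nnegrE ?mulr_ge0 ?cnorm_ge0 //.
rewrite !exprMn !cnorm_sqr.
rewrite [leRHS](_ : _ = (2 * Rm * inner k (up_ki k i gi) (up_ki k i gi))
  * (2 * Rm * inner k (up_ki k j gj) (up_ki k j gj))); last by ring.
by rewrite ler_pM ?inner_ge0 // up_ki_H_norm.
Qed.

(* If ker D_j = 0 then 1_s = U g, and |g|^2 is both at least |1_s|^4 / |D 1_s|^2,
   which non-laziness makes large, and at most about R |1_s|^2. *)
Lemma H_space_nontrivial j : (j <= k)%N -> exists2 g, @H_space R P j g & g != 0.
Proof.
move=> jk; have [s rs] := exists_rk Dwd (leq_trans jk (ltnW kd)).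
have n1 : indic [set s] s = 1 :> R by rewrite ffunE inE eqxx.
have ci : cochain j (indic [set s] : {ffun P -> R}) by rewrite -rs; apply: indic_cochain.
have i0 : (indic [set s] : {ffun P -> R}) != 0.
  by apply/eqP => /ffunP/(_ s); rewrite n1 ffunE => /eqP; rewrite oner_eq0.
case: j jk rs ci => [|j] jk rs ci; first by exists (indic [set s]).
have [g gj Dg] := up_projection Dwd (leq_ltn_trans jk kd) ci.
have [E|ne] := eqVneq (indic [set s] - up_op g) 0; last first.
  exists (indic [set s] - up_op g) => //; split => //.
  by apply: cochainB => //; apply: cochain_up.
have {}E : indic [set s] = up_op g by apply/eqP; rewrite -subr_eq0 E.
have jd : (j < d)%N by lia.
have r1 := reg_max_ge1; have rp : 0 < Rm by apply: lt_le_trans r1.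
have low : inner j g g <= 2 * Rm * inner j.+1 (up_op g) (up_op g).
  rewrite inner_up //.
  have := down_up_approx Dwd Pep Pnl d_gt0 jd gj.
  set e := _ - _ - _ => ne.
  have -> : down_op (up_op g)
    = e + scalef (delta j) (up_op (down_op g)) + scalef (1 - delta j) g.
    by rewrite /e !subrK.
  clearbody e.
  have kap := @kappa_ge _ _ _ _ Dwd Pep Pnl d_gt0 k j (ltnW jk) (ltnW kd).
  (* The first factor of [kappa] is 1 - delta_j and the others are at most 1, so 1 - delta_j
     inherits the lower bound. *)
  have dj : kappa delta k j j <= 1 - delta j.
    rewrite /kappa big_ltn //= /dprod big_nat1.
    have /andP[q0 q1] := delta01 Pep jd.
    rewrite ler_piMr ?subr_ge0 //.
    by have /andP[_] := @kappa01 _ _ _ _ Pep d_gt0 k j.+1 j (ltnW kd).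
  have UD0 : 0 <= inner j (up_op (down_op g)) g.
    case: (j) jd gj => [|j'] jd' gj'; first by rewrite (down_cochain0 gj') raddf0 inner0l.
    by rewrite inner_up ?inner_ge0 // ltnW.
  have /andP[q0 _] := delta01 Pep jd.
  have gg := inner_ge0 j g.
  have ne' : `|inner j g e| <= gamma * inner j g g.
    apply: le_trans (cauchy_schwarz _ _ _) _; rewrite -cnorm_sqr expr2 mulrA mulrC.
    by rewrite ler_wpM2r ?cnorm_ge0.
  rewrite !innerDr !innerZr [inner j g (up_op _)]innerC.
  move: ne'; rewrite ler_norml => /andP[ne' _].
  have m1 : 0 <= delta j * inner j (up_op (down_op g)) g by rewrite mulr_ge0.
  have ri : Rm^-1 <= (reg P k j)%:R^-1.
    have r1' := reg_ge1 (ltnW jk).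
    by rewrite lef_pV2 ?posrE ?reg_le_max ?(ltnW jk) // (lt_le_trans ltr01).
  have kk := k_ge1.
  have sm : 3 * k%:R ^+ 2 * gamma * Rm <= 2^-1.
    have := gamma_small2.
    have : 0 <= k%:R ^+ 2 * Rm * gamma by rewrite !mulr_ge0 ?exprn_ge0 // ltW.
    lra.
  have k2 : gamma <= k%:R ^+ 2 * gamma.
    by rewrite ler_peMl // exprn_ege1.
  have dl : Rm^-1 - 3 * k%:R ^+ 2 * gamma <= 1 - delta j - gamma.
    rewrite natrX in kap; lra.
  have m2 : (Rm^-1 - 3 * k%:R ^+ 2 * gamma) * inner j g g
      <= (1 - delta j - gamma) * inner j g g by rewrite ler_wpM2r.
  have m3 : inner j g g <= 2 * Rm * ((Rm^-1 - 3 * k%:R ^+ 2 * gamma) * inner j g g).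
    rewrite mulrA ler_peMl //.
    have -> : 2 * Rm * (Rm^-1 - 3 * k%:R ^+ 2 * gamma)
       = 2 - 2 * (3 * k%:R ^+ 2 * gamma * Rm) by field; rewrite gt_eqF.
    lra.
  apply: le_trans m3 _; rewrite ler_wpM2l ?mulr_ge0 //; apply: le_trans m2 _.
  lra.
have ps : 0 < piw s by apply: piw_gt0 => //; rewrite rs; lia.
have h1 : inner j.+1 (up_op g) (up_op g) = piw s.
  by rewrite -E -rs inner_indic n1 mulr1.
have h2 : inner j g (down_op (indic [set s])) = piw s.
  by rewrite -inner_up // -E -rs inner_indic n1 mulr1.
have h3 : inner j (down_op (indic [set s])) (down_op (indic [set s])) <= gamma * piw s.
  rewrite -inner_up // -rs inner_indic mulrC ler_wpM2r ?(ltW ps) //.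
  by apply: Pnl; rewrite rs.
have := cauchy_schwarz_sqr j g (down_op (indic [set s])).
rewrite h2 => h4; rewrite h1 in low.
have h5 : piw s ^+ 2 <= (2 * Rm * piw s) * (gamma * piw s).
  by apply: le_trans h4 _; rewrite ler_pM ?inner_ge0.
have : piw s ^+ 2 <= (2 * Rm * gamma) * piw s ^+ 2.
  by apply: le_trans h5 _; rewrite le_eqVlt; apply/orP; left; apply/eqP; ring.
rewrite -[leLHS]mul1r ler_pM2r ?exprn_gt0 //.
have := gamma_small2; have := k_ge1 => k1.
have : Rm * gamma <= k%:R ^+ 2 * (Rm * gamma).
  by rewrite ler_peMl ?mulr_ge0 // exprn_ege1.
have : 0 <= Rm * gamma by rewrite mulr_ge0.
move=> a0 a1 a2 a3; exfalso; lra.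
Qed.

End SmallGamma.


Lemma card_ord_lt n m : (m <= n)%N -> #|[set i : 'I_n | (i < m)%N]| = m.
Proof.
move=> mn; have inj : injective (widen_ord mn).
  by move=> s t /(congr1 val) e; apply: val_inj.
rewrite -[RHS]card_ord -(card_imset predT inj); apply: eq_card => i; rewrite inE.
apply/idP/imsetP => [im|[s _ ->]]; last exact: (ltn_ord s).
by exists (Ordinal im) => //; apply: val_inj.
Qed.

(** * Indicators, pseudorandomness and expansion *)

Section Pseudorandomness.
Variables (R : realType) (P : measured_poset R).
Hypothesis Dwd : D_well_defined P.
Local Notation d := (poset_dim P).
Variables (k : nat) (S : {set P}).
Hypothesis kd : (k < d)%N.
Hypothesis S_neq0 : S != set0.
Hypothesis S_rk : forall x, x \in S -> rk x = k.
Implicit Types (f g h : {ffun P -> R}) (x y : P) (a b : R) (i j l m : nat).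
Local Notation f := (indic S : {ffun P -> R}).
Local Notation mu := (density S : R).

Lemma cochain_indic : cochain k f.
Proof. by move=> x rx; rewrite ffunE; case xS: (x \in S) => //; rewrite (S_rk xS) eqxx in rx. Qed.

Lemma density_expect : mu = expect k f.
Proof.
rewrite /density /expect [RHS](bigID (fun x => x \in S)) /= [X in _ + X]big1 ?addr0.
  apply: eq_big => [x|x xS]; last by rewrite ffunE xS mulr1.
  by apply/idP/andP => [xS|[]//]; rewrite (S_rk xS) eqxx.
by move=> x /andP[_ xS]; rewrite ffunE (negPf xS) mulr0.
Qed.

Lemma inner_indic_self : inner k f f = mu.
Proof.
rewrite density_expect; apply: eq_bigr => x _; rewrite ffunE.
by case: (x \in S); rewrite ?mulr1 ?mulr0.
Qed.

Lemma density_gt0 : 0 < mu.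
Proof.
have /set0Pn[x xS] := S_neq0; rewrite /density (bigD1 x) //=.
apply: ltr_wpDr; first by apply: sumr_ge0 => y _; apply: piw_ge0.
by apply: piw_gt0 => //; rewrite (S_rk xS).
Qed.

Lemma density_le1 : mu <= 1.
Proof.
rewrite density_expect -(sum_piw Dwd (ltnW kd)) /expect; apply: ler_sum => x _.
by rewrite ler_piMr ?piw_ge0 // ffunE; case: (x \in S); rewrite ?ler01.
Qed.

(** The function h = D^k_i 1_S is nonnegative with mean mu, so <h, h> <= (max h) E[h] <= (mu +
    eps_i) mu. Squaring the sup bound would instead give eps_i^2, without the factor mu. *)
Lemma l2_of_linf r eps : (r <= k)%N ->
  linf_pseudorandom k r eps f -> l2_pseudorandom k r eps f.
Proof.
move=> rk_ H i ir; have ik : (i <= k)%N by case/andP: ir => _ /leq_trans; apply.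
have kd' := ltnW kd.
have Hi := H i ir; set h := down_ki k i f in Hi *.
have hE : expect i h = expect k f by rewrite /h expect_down_ki.
rewrite /variance hE -density_expect.
suff : inner i h h <= (mu + eps i) * expect i h.
  rewrite hE -density_expect mulrDl expr2; lra.
rewrite /expect mulr_sumr; apply: ler_sum => x /eqP rx.
have h0 : 0 <= h x.
  by have /andP[] := bounded_down_ki Dwd k i ler01 (bounded_indic S) x.
rewrite mulrC ler_wpM2r ?mulr_ge0 ?piw_ge0 //.
have := Hi x rx; rewrite -density_expect ler_norml => /andP[_]; lra.
Qed.

Lemma pseudorandom_eps_ge0 r eps i : (1 <= i <= r)%N -> (r <= k)%N ->
  l2_pseudorandom k r eps f -> 0 <= eps i.
Proof.
move=> ir rk_ /(_ i ir); rewrite -density_expect => H.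
have ik : (i <= k)%N by case/andP: ir => _ /leq_trans; apply.
have : 0 <= variance i (down_ki k i f).
  rewrite /variance subr_ge0 expectE.
  apply: le_trans (cauchy_schwarz_sqr _ _ _) _.
  have -> : inner i (constf P 1) (constf P 1) = 1 :> R.
    rewrite -expectE; apply: etrans (sum_piw Dwd (leq_trans ik (ltnW kd))).
    by apply: eq_bigr => x _; rewrite ffunE mulr1.
  by rewrite mulr1.
by move=> /le_trans/(_ H); rewrite pmulr_lge0 // density_gt0.
Qed.

Lemma expect_H_space i g : (0 < i <= k)%N -> H_space i g -> expect i g = 0.
Proof.
case: i => [//|i] ik Hg; have id : (i < d)%N := ltn_trans ik kd.
by rewrite -(expect_down Dwd _ id) (H_space_down Hg) expectE inner0l.
Qed.

(** Functions in ker D_i have mean 0, so D^k_i 1_S may be centred before Cauchy-Schwarz; its squared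
    norm is then the variance. *)
Lemma inner_H_space_sqr i g e : (0 < i <= k)%N -> H_space i g ->
  variance i (down_ki k i f) <= e * mu ->
  inner k f (up_ki k i g) ^+ 2 <= e * mu * inner i g g.
Proof.
move=> ik Hg Hv; have ik' : (i <= k)%N by lia.
have kd' := ltnW kd.
set h := down_ki k i f in Hv.
have hE : expect i h = mu by rewrite /h expect_down_ki // density_expect.
pose F := h - constf P mu.
have cE a (u : {ffun P -> R}) : inner i (constf P a) u = a * expect i u.
  by rewrite /expect mulr_sumr; apply: eq_bigr => x _; rewrite ffunE; ring.
have -> : inner k f (up_ki k i g) = inner i F g.
  rewrite innerC inner_up_ki // innerC /F innerDl innerNl cE.
  by rewrite (expect_H_space ik Hg) mulr0 subr0.
apply: le_trans (cauchy_schwarz_sqr _ _ _) _.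
rewrite ler_wpM2r ?inner_ge0 //; apply: le_trans Hv.
have c1 : expect i (constf P mu) = mu.
  rewrite /expect (eq_bigr (fun x => piw x * mu)); last by move=> x _; rewrite ffunE.
  by rewrite -mulr_suml sum_piw ?mul1r // (leq_trans ik').
rewrite /F innerDl !innerDr !innerNl !innerNr (innerC i h) !cE c1 /variance hE.
by rewrite le_eqVlt; apply/orP; left; apply/eqP; ring.
Qed.

Variables (alpha : {fsfun seq bool -> R with 0}).
Hypothesis walk_alpha : hd_walk P k alpha.
Local Notation M := (hd_op P alpha).

Lemma hd_transition g v : cochain k g ->
  M g v = \sum_(y | rk y == k) g y * transition M v y.
Proof.
move=> gk; have -> : M g v = M (\sum_(y | rk y == k) scalef (g y) (indic [set y])) v.
  congr (M _ v); apply/ffunP => x; rewrite sum_ffunE.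
  have [rx|rx] := eqVneq (rk x) k; last first.
    rewrite gk // big1 // => y /eqP ry; rewrite !ffunE inE.
    by case: eqP => [E|_]; rewrite ?mulr0 //; rewrite E ry eqxx in rx.
  rewrite (bigD1 x) ?rx //= big1 ?addr0; first by rewrite !ffunE inE eqxx mulr1.
  by move=> y /andP[_ yx]; rewrite !ffunE inE eq_sym (negPf yx) mulr0.
rewrite raddf_sum sum_ffunE; apply: eq_bigr => y _.
by rewrite /= hd_scalef ffunE.
Qed.

Lemma expansion_ge0 : 0 <= expansion k M S.
Proof.
case: walk_alpha => _ _ st _; apply: sumr_ge0 => v vS.
rewrite mulr_ge0 ?divr_ge0 ?piw_ge0 ?(ltW density_gt0) //.
apply: sumr_ge0 => y /andP[/eqP ry _].
by have [H _] := st v (S_rk vS); apply: H.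
Qed.

Lemma expansionE : expansion k M S = 1 - inner k f (M f) / mu.
Proof.
case: walk_alpha => _ _ st _.
have m0 := density_gt0.
rewrite /expansion (eq_bigr (fun v => piw v / mu - piw v * M f v / mu)); last first.
  move=> v vS; have [_ s1] := st v (S_rk vS).
  rewrite (hd_transition _ cochain_indic).
  have -> : \sum_(y | (rk y == k) && (y \notin S)) transition M v y
    = 1 - \sum_(y | rk y == k) f y * transition M v y.
    have -> : \sum_(y | rk y == k) f y * transition M v y
       = \sum_(y | (rk y == k) && (y \in S)) transition M v y.
      rewrite big_mkcondr; apply: eq_bigr => y _; rewrite [f y]ffunE.
      by case: (y \in S); rewrite ?mul1r ?mul0r.
    by rewrite -s1 [X in _ = X - _](bigID (fun y => y \in S)) /= addrAC subrr add0r.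
  by field; rewrite gt_eqF.
rewrite sumrB -!mulr_suml -/(density S) mulfV ?gt_eqF //; congr (1 - _ / _).
rewrite /inner [RHS](bigID (fun x => x \in S)) /= [X in _ = _ + X]big1 ?addr0.
  apply: eq_big => [x|x xS]; last by rewrite [X in _ * X * _]ffunE xS mulr1.
  by apply/idP/andP => [xS|[]//]; rewrite (S_rk xS) eqxx.
by move=> x /andP[_ xS]; rewrite [X in _ * X * _]ffunE (negPf xS) mulr0 mul0r.
Qed.

End Pseudorandomness.

(** * Eigenvalues of M and the stripped threshold rank *)

Section Stripping.
Variables (R : realType) (P : measured_poset R).
Variables (delta : nat -> R) (gamma : R).
Hypothesis Dwd : D_well_defined P.
Hypothesis Pep : eposet P delta gamma.
Hypothesis Pnl : non_lazy P gamma.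
Local Notation d := (poset_dim P).
Variable k : nat.
Hypothesis k_gt0 : (0 < k)%N.
Hypothesis kd : (k < d)%N.
Local Notation Rm := ((reg_max P k)%:R : R).
Variables (alpha : {fsfun seq bool -> R with 0}) (c : nat -> R) (eta : R).
Hypothesis walk_alpha : hd_walk P k alpha.
Local Notation M := (hd_op P alpha).
Local Notation lambda := (fun j => hd_lambda delta k j alpha).
Local Notation r := (stripped_threshold_rank P delta k alpha c eta).-1.
Hypothesis c_ge0 : forall j, (j <= k)%N -> 0 <= c j.
Hypothesis c_approx : forall j, (j <= k)%N -> forall f, V_space P k j f ->
  cnorm k [ffun x => M f x - lambda j * f x] <= c j * cnorm k f.
Hypothesis c_sep : forall j, (j < k)%N -> c j + c j.+1 < lambda j - lambda j.+1.

Let d_gt0 : (0 < d)%N := ltn_trans k_gt0 kd.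

Let T : {set 'I_k.+1} := [set j : 'I_k.+1 | `[< exists mu,
       [/\ eigenvalue_on k M mu, eta < mu &
           mu \in `[lambda j - c j, lambda j + c j]] >]].

Lemma interval_sep i j : (i < j <= k)%N -> c i + c j < lambda i - lambda j.
Proof.
elim: j => [//|j IH] /andP[ij jk].
have s := c_sep jk; have cj := c_ge0 (ltnW jk).
move: ij; rewrite ltnS leq_eqVlt => /orP[/eqP -> //|ij].
have := IH; rewrite ij (ltnW jk) => /(_ isT); lra.
Qed.

Lemma stripped_le : (r <= k)%N.
Proof.
rewrite /stripped_threshold_rank -ltnS.
apply: (@leq_ltn_trans (#|'I_k.+1|.-1)); last by rewrite card_ord.
by rewrite -!subn1 leq_sub2r // max_card.
Qed.

(** J_0 is centred at lambda_0 = 1 and all other intervals lie below it, hence below 1: only index 0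
    can be counted. *)
Lemma stripped_eta_ge1 : 1 <= eta -> r = 0%N.
Proof.
move=> e1; suff : (#|T| <= 1)%N.
  by rewrite /stripped_threshold_rank -/T; case: #|T| => [|[]].
rewrite -(cards1 (ord0 : 'I_k.+1)); apply/subset_leq_card/subsetP => j.
rewrite inE => /asboolP[mu [_ emu]]; rewrite in_itv /= => /andP[_ mle].
rewrite inE; apply/eqP/val_inj; case: (posnP j) => // j0; exfalso.
have jk : (j <= k)%N by rewrite -ltnS.
have := @interval_sep 0 j; rewrite j0 jk => /(_ isT).
rewrite (hd_lambda0 Pep d_gt0 walk_alpha); have := c_ge0 (leq0n k); lra.
Qed.

Hypothesis gamma_small : 16 * k%:R ^+ 3 * Rm * gamma <= 1.
Local Notation E := (hd_weight alpha * (hd_height alpha * (hd_height alpha + k))%:R).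
Local Notation rho0 := (2 * Rm * E * gamma).

Let g0 : 0 <= gamma := gamma_ge0 Dwd Pnl d_gt0.

Lemma rho0_ge0 : 0 <= rho0.
Proof.
have w1 := hd_weight_ge1 walk_alpha.
by rewrite !mulr_ge0 ?(le_trans ler01 w1).
Qed.

(** [c j] keeps the intervals disjoint, [rho0] makes them O(gamma). The factor 2 R_max in [rho0] is
    a crude bound for the sqrt(2 R_max) lost in passing from g to U^k_j g. *)
Lemma hd_approx_V j f : (j <= k)%N -> V_space P k j f ->
  cnorm k (M f - scalef (lambda j) f) <= Num.min (c j) rho0 * cnorm k f.
Proof.
move=> jk fV; have := c_approx jk fV.
have -> : [ffun x => M f x - lambda j * f x] = M f - scalef (lambda j) f.
  by apply/ffunP => x; rewrite !ffunE.
rewrite minEle; case: ifP => // _ _.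
case: fV => g Hg ->; have := hd_approx Dwd Pep Pnl d_gt0 kd walk_alpha jk Hg.
move/le_trans; apply.
rewrite [leRHS](_ : _ = E * gamma * (2 * Rm * cnorm k (up_ki k j g))); last by ring.
have w1 := hd_weight_ge1 walk_alpha.
rewrite ler_wpM2l ?mulr_ge0 ?(le_trans ler01 w1) //.
have r1 := reg_max_ge1 Dwd kd.
apply: cnorm_le; first by rewrite !mulr_ge0 ?cnorm_ge0.
rewrite exprMn cnorm_sqr; apply: le_trans (up_ki_H_norm Dwd Pep Pnl k_gt0 kd gamma_small jk Hg) _.
rewrite ler_wpM2r ?inner_ge0 // expr2 ler_peMl ?mulr_ge0 //; lra.
Qed.

Lemma hd_eigenvalues :
  (forall mu, eigenvalue_on k M mu ->
     exists2 j, (j <= k)%N & `|mu - lambda j| <= Num.min (c j) rho0) /\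
  (forall j f, (j <= k)%N -> V_space P k j f -> f != 0 ->
    exists2 mu, eigenvalue_on k M mu & `|mu - lambda j| <= Num.min (c j) rho0).
Proof.
apply: level_eigenvalues => //.
- exact: hd_op_is_additive.
- exact: hd_scalef.
- exact: cochain_hd.
- by case: walk_alpha.
- by move=> j jk; rewrite le_min c_ge0 // rho0_ge0.
- exact: hd_approx_V.
- move=> i j ij; apply: le_lt_trans (interval_sep ij).
  by rewrite lerD // ge_min lexx.
Qed.

Lemma V_space_nontrivial j : (j <= k)%N -> exists2 f, V_space P k j f & f != 0.
Proof.
move=> jk; have [g Hg g_neq0] := H_space_nontrivial Dwd Pep Pnl k_gt0 kd gamma_small jk.
exists (up_ki k j g); first by exists g.
apply: contraNneq g_neq0 => f0.
have := up_ki_H_norm Dwd Pep Pnl k_gt0 kd gamma_small jk Hg.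
rewrite f0 inner0l mulr0 => h; apply/eqP; apply: (cnorm_eq0 Dwd (leq_ltn_trans jk kd)).
  by case: Hg.
by rewrite /cnorm (_ : inner j g g = 0) ?sqrtr0 //; apply/eqP; rewrite eq_le h inner_ge0.
Qed.

Lemma level_has_eigenvalue j : (j <= k)%N ->
  exists2 mu, eigenvalue_on k M mu & `|mu - lambda j| <= Num.min (c j) rho0.
Proof.
move=> jk; have [f fV f0] := V_space_nontrivial jk.
by have [_ H] := hd_eigenvalues; apply: H fV f0.
Qed.

Lemma norm_le_min a b e : `|a - b| <= Num.min e rho0 ->
  [/\ b - e <= a, a <= b + e, b - rho0 <= a & a <= b + rho0].
Proof.
rewrite le_min !ler_norml => /andP[/andP[h1 h2] /andP[h3 h4]].
by split; [move: h1|move: h2|move: h3|move: h4] => h; lra.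
Qed.

(** Level [i] contributes an eigenvalue of its own, in an interval lying above that of [j]. So [T]
    is an initial segment, and its cardinality determines its elements. *)
Lemma stripped_set_downward (i j : 'I_k.+1) : (i < j)%N -> j \in T -> i \in T.
Proof.
move=> ij; rewrite !inE => /asboolP[mu [_ emu]]; rewrite in_itv /= => /andP[_ mle].
apply/asboolP; have jk : (j <= k)%N by rewrite -ltnS.
have ik : (i <= k)%N by rewrite -ltnS.
have [nu nue /norm_le_min[n1 n2 _ _]] := level_has_eigenvalue ik.
exists nu; split => //; last by rewrite in_itv /= n1 n2.
have := @interval_sep i j; rewrite ij jk => /(_ isT); lra.
Qed.

(** Index 0 is excluded because [r] is a truncated predecessor: it is 0 also when [T] is empty. *)
Lemma mem_stripped_set (j : 'I_k.+1) : (0 < j <= r)%N -> j \in T.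
Proof.
move=> /andP[j0 jr]; apply/negPn/negP => jT.
suff : (#|T| <= j)%N.
  by move: jr; rewrite /stripped_threshold_rank -/T; move: #|T| => n; lia.
rewrite -[leqRHS](@card_ord_lt k.+1); last exact: ltnW.
apply/subset_leq_card/subsetP => i iT; rewrite inE ltnNge; apply/negP.
rewrite leq_eqVlt => /orP[/eqP/val_inj E|ji]; first by rewrite E iT in jT.
by rewrite (stripped_set_downward ji iT) in jT.
Qed.

Lemma notin_stripped_set (j : 'I_k.+1) : (r < j)%N -> j \notin T.
Proof.
move=> rj; apply/negP => jT.
suff : (j < #|T|)%N.
  by move: rj; rewrite /stripped_threshold_rank -/T; move: #|T| => n; lia.
rewrite -[leqLHS](@card_ord_lt k.+1 j.+1) //.
apply/subset_leq_card/subsetP => i; rewrite inE ltnS leq_eqVlt => /orP[/eqP/val_inj -> //|ij].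
exact: stripped_set_downward jT.
Qed.

(** The eigenvalue above eta in J_j is within [rho0] of some lambda_i while lying in J_i;
    disjointness forces i = j. *)
Lemma lambda_above j : (0 < j <= r)%N -> eta <= lambda j + rho0.
Proof.
move=> jr; have jk : (j < k.+1)%N by have := stripped_le; lia.
have := @mem_stripped_set (Ordinal jk) jr; rewrite inE => /asboolP[mu [mue emu]].
rewrite in_itv /= => /andP[m1 m2].
have [H _] := hd_eigenvalues; have [i ik /norm_le_min[n1 n2 n3 n4]] := H mu mue.
have [lt|lt|E] := ltngtP i j.
- have := @interval_sep i j; rewrite lt -ltnS jk => /(_ isT); lra.
- have := @interval_sep j i; rewrite lt ik => /(_ isT); lra.
- rewrite E in n4; lra.
Qed.

(** The eigenvalue that level [j] provides lies in J_j, so it would make [j] counted if it exceeded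
    eta. *)
Lemma lambda_below j : (r < j <= k)%N -> lambda j <= eta + rho0.
Proof.
move=> /andP[rj jk]; have [mu mue /norm_le_min[n1 n2 n3 n4]] := level_has_eigenvalue jk.
have := @notin_stripped_set (Ordinal (jk : (j < k.+1)%N)) rj; rewrite inE => /asboolP nT.
have [le|gt] := lerP mu eta; first by lra.
by exfalso; apply: nT; exists mu; split => //; rewrite in_itv /= n1 n2.
Qed.

End Stripping.


(** Used with r = R(k,i), kap = k^2 gamma, a = <1_S, f_i> and s = |f_i|^2. If s were a, dividing by
    a would do. Arguing by contradiction supplies a > r e mu, so that e mu / a <= 1/r controls the
    error of replacing s by a; and 9 is 3 times the 3 of a <= 3 mu. *)
Lemma coefficient_bound (R : realFieldType) (r kap tau e mu a s : R) :
  1 <= r -> 0 <= kap -> 0 <= tau <= 1 -> 0 <= e -> 0 < mu ->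
  (r^-1 - 3 * kap) * a ^+ 2 <= e * mu * s ->
  `|a - s| <= tau * mu -> s <= 2 * mu ->
  a <= r * e * mu + (tau + 9 * r * kap) * mu.
Proof.
move=> r1 k0 /andP[t0 t1] e0 mu0 H; rewrite ler_norml => /andP[as1 as2] s2.
have rp : 0 < r by apply: lt_le_trans r1.
have X0 : 0 <= e * mu by rewrite mulr_ge0 // ltW.
rewrite leNgt; apply/negP => alt.
have tm : tau * mu <= mu by rewrite ler_piMl // ltW.
have tm0 : 0 <= tau * mu by rewrite mulr_ge0 // ltW.
have km0 : 0 <= 9 * r * kap * mu by rewrite !mulr_ge0 // ltW.
have rX0 : 0 <= r * (e * mu) by rewrite mulr_ge0 // ltW.
have aX : r * (e * mu) < a by lra.
have ap : 0 < a by lra.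
have Xa : e * mu <= a * r^-1 by rewrite ler_pdivlMr // mulrC ltW.
have h1 : e * mu * s <= e * mu * (a + tau * mu) by rewrite ler_wpM2l //; lra.
have h2 : e * mu * (tau * mu) <= a * r^-1 * (tau * mu) by rewrite ler_wpM2r.
have h3 : (r^-1 - 3 * kap) * a <= e * mu + r^-1 * (tau * mu).
  rewrite -(ler_pM2r ap); move: H h1 h2; rewrite expr2; lra.
have h4 : r * ((r^-1 - 3 * kap) * a) <= r * (e * mu + r^-1 * (tau * mu)).
  by rewrite ler_pM2l.
have e1 : r * ((r^-1 - 3 * kap) * a) = a - 3 * r * kap * a by field; rewrite gt_eqF.
have e2 : r * (e * mu + r^-1 * (tau * mu)) = r * (e * mu) + tau * mu.
  by field; rewrite gt_eqF.
rewrite e1 e2 in h4.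
have h5 : 3 * r * kap * a <= 3 * r * kap * (3 * mu).
  by rewrite ler_wpM2l ?mulr_ge0 ?(ltW rp) //; lra.
lra.
Qed.

Lemma sum_self_le (R : realDomainType) n (F : 'I_n -> R) j :
  (forall i, 0 <= F i) -> F j <= \sum_i F i.
Proof. by move=> F0; rewrite (bigD1 j) //= lerDl sumr_ge0. Qed.

(** * The components of an indicator *)

Section QuadraticForm.
Variables (R : realType) (P : measured_poset R).
Variables (delta : nat -> R) (gamma : R).
Hypothesis Dwd : D_well_defined P.
Hypothesis Pep : eposet P delta gamma.
Hypothesis Pnl : non_lazy P gamma.
Local Notation d := (poset_dim P).
Variable k : nat.
Hypothesis k_gt0 : (0 < k)%N.
Hypothesis kd : (k < d)%N.
Local Notation Rm := ((reg_max P k)%:R : R).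
Hypothesis gamma_small : 16 * k%:R ^+ 3 * Rm * gamma <= 1.
Variable S : {set P}.
Hypothesis S_neq0 : S != set0.
Hypothesis S_rk : forall x, x \in S -> rk x = k.
Local Notation f := (indic S : {ffun P -> R}).
Local Notation mu := (density S : R).
Local Notation theta := (2 * Rm * k%:R ^+ 2 * gamma).
Local Notation tau := (6 * k%:R ^+ 3 * Rm * gamma).

Let d_gt0 : (0 < d)%N. Proof. exact: (ltn_trans k_gt0 kd). Qed.
Let g0 : 0 <= gamma. Proof. exact: (gamma_ge0 Dwd Pnl d_gt0). Qed.
Let mu0 : 0 < mu. Proof. exact: (density_gt0 Dwd kd S_neq0 S_rk). Qed.
Let r1 : 1 <= Rm. Proof. exact: (reg_max_ge1 Dwd kd). Qed.
Let k1 : 1 <= k%:R :> R. Proof. exact: (k_ge1 R k_gt0). Qed.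

Variable g : nat -> {ffun P -> R}.
Hypothesis Hg : forall j, H_space j (g j).
Hypothesis f_sum : f = \sum_(0 <= j < k.+1) up_ki k j (g j).
Local Notation F := (fun j => up_ki k j (g j)).
Local Notation n := (fun j => cnorm k (F j)).

Lemma expect_up_ki i (h : {ffun P -> R}) : (i <= k)%N -> expect k (up_ki k i h) = expect i h.
Proof.
move=> ik; have kd' := kd; rewrite -(subnKC ik) in kd' *.
elim: (k - i)%N kd' => [|m IH] kd'; first by rewrite addn0 up_kinn.
rewrite addnS in kd' *; by rewrite up_kiS ?leq_addr // expect_up ?IH // ltnW.
Qed.

(** X(0) being a point, f_0 is constant on X(k); the other components have mean 0, so the constant
    is mu. *)
Lemma component0 : inner k f (F 0%N) = mu ^+ 2.
Proof.
have [x0 rx0] := exists_rk Dwd (leq0n d).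
have F0 x : rk x = k -> F 0%N x = g 0%N x0.
  move=> rx; rewrite -[RHS](up_ki_constf Dwd (g 0%N x0) (leq0n k) rx).
  apply: up_ki_eq => // y ry; rewrite ffunE.
  have : x0 \in [set x : P | rk x == 0%N] by rewrite inE rx0.
  have : y \in [set x : P | rk x == 0%N] by rewrite inE ry.
  have /eqP/cards1P[t ->] := card_rk0 P.
  by rewrite !inE => /eqP -> /eqP ->.
have E : mu = g 0%N x0.
  rewrite (density_expect S_rk) f_sum expectE inner_suml big_nat_recl //=.
  rewrite big_nat_cond big1 ?addr0; last first.
    move=> j /andP[/andP[_ jk] _]; rewrite -expectE expect_up_ki //.
    have jk2 : (0 < j.+1 <= k)%N by [].
    exact: (expect_H_space Dwd kd jk2 (Hg _)).
  rewrite -expectE -[RHS]mulr1 -(sum_piw Dwd (ltnW kd)) mulr_sumr.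
  by apply: eq_bigr => x /eqP rx; rewrite (F0 x rx) mulrC.
rewrite /inner (eq_bigr (fun x => piw x * f x * mu)); last first.
  by move=> x /eqP rx; rewrite (F0 x rx) E.
by rewrite -mulr_suml -/(expect k f) -(density_expect S_rk) expr2.
Qed.

Lemma theta_ge0 : 0 <= theta.
Proof. by rewrite !mulr_ge0 ?exprn_ge0. Qed.

Let N := \sum_(j < k.+1) n j.

Lemma component_cross (j : 'I_k.+1) :
  `|inner k f (F j) - n j ^+ 2| <= theta * (n j * N).
Proof.
rewrite {1}f_sum big_mkord inner_suml (bigD1 j) //= -cnorm_sqr addrAC subrr add0r.
apply: le_trans (ler_norm_sum _ _ _) _.
rewrite /N mulr_sumr mulr_sumr [leRHS](bigD1 j) //= -[leLHS]add0r lerD //.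
  by rewrite !mulr_ge0 ?exprn_ge0 ?cnorm_ge0.
apply: ler_sum => i ij; rewrite [n j * n i]mulrC.
have ik : (i <= k)%N by rewrite -ltnS.
have jk : (j <= k)%N by rewrite -ltnS.
by apply: (cross_terms Dwd Pep Pnl k_gt0 kd gamma_small ik jk) => //; apply: Hg.
Qed.

Lemma density_components : mu = \sum_(j < k.+1) inner k f (F j).
Proof. by rewrite -(inner_indic_self S_rk) {2}f_sum big_mkord inner_sumr. Qed.

Lemma sum_norms_sqr : N ^+ 2 <= k.+1%:R * \sum_(j < k.+1) n j ^+ 2.
Proof.
have := @sum_sqr_le R 'I_k.+1 predT (fun j => n j).
by rewrite [#|_|]card_ord.
Qed.

(** A bootstrap: the left side s satisfies s <= mu + theta N^2 <= mu + theta (k+1) s, and the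
    constant 16 of the smallness assumption makes theta (k+1) at most 1/4. *)
Lemma sum_norms_le : \sum_(j < k.+1) n j ^+ 2 <= 2 * mu.
Proof.
set s := \sum_(j < k.+1) n j ^+ 2.
have s0 : 0 <= s by apply: sumr_ge0 => j _; apply: sqr_ge0.
have h : s <= mu + theta * N ^+ 2.
  have -> : theta * N ^+ 2 = \sum_(j < k.+1) theta * (n j * N).
    by rewrite -mulr_sumr -mulr_suml expr2.
  rewrite density_components -big_split /=.
  apply: ler_sum => j _; have := component_cross j.
  rewrite ler_norml => /andP[+ _]; lra.
have h2 : theta * N ^+ 2 <= theta * (k.+1%:R * s) by rewrite ler_wpM2l ?theta_ge0 // sum_norms_sqr.
have h3 : theta * k.+1%:R <= 4^-1.
  have : theta * k.+1%:R <= theta * (2 * k%:R).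
    by rewrite ler_wpM2l ?theta_ge0 // -natr1; have := k1; lra.
  have -> : theta * (2 * k%:R) = 4^-1 * (16 * k%:R ^+ 3 * Rm * gamma) by field.
  have := gamma_small; lra.
have h4 : theta * k.+1%:R * s <= 4^-1 * s by rewrite ler_wpM2r.
rewrite mulrA in h2; have := mu0; lra.
Qed.

Lemma component_norm_le (j : 'I_k.+1) : n j ^+ 2 <= 2 * mu.
Proof.
apply: le_trans sum_norms_le.
by apply: (sum_self_le (F := fun j : 'I_k.+1 => n j ^+ 2)) => i; apply: sqr_ge0.
Qed.

Lemma component_approx (j : 'I_k.+1) : `|inner k f (F j) - n j ^+ 2| <= tau * mu.
Proof.
apply: le_trans (component_cross j) _.
have h1 := component_norm_le j; have h2 := sum_norms_le; have h3 := sum_norms_sqr.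
have h4 : N ^+ 2 <= k.+1%:R * (2 * mu) by apply: le_trans h3 _; rewrite ler_wpM2l.
(* The product is at most half the sum of squares, thus at most (k+2) mu <= 3 k mu as k >= 1; times
   theta this is tau mu. *)
have h5 : n j * N <= 3 * k%:R * mu.
  have : 0 <= (n j - N) ^+ 2 by apply: sqr_ge0.
  rewrite sqrrB => h6.
  have h7 : mu <= k%:R * mu by rewrite ler_peMl // ltW.
  move: h4; rewrite -natr1 => h4; lra.
rewrite [leRHS](_ : _ = theta * (3 * k%:R * mu)); last by ring.
by rewrite ler_wpM2l ?theta_ge0.
Qed.

Lemma tau01 : 0 <= tau <= 1.
Proof.
have t0 : 0 <= tau by rewrite !mulr_ge0 ?exprn_ge0.
by apply/andP; split => //; have := gamma_small; lra.
Qed.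

Lemma component_ge (j : 'I_k.+1) : - (tau * mu) <= inner k f (F j).
Proof.
have := component_approx j; rewrite ler_norml => /andP[h _].
have := sqr_ge0 (n j); lra.
Qed.

Lemma component_le (j : 'I_k.+1) : inner k f (F j) <= 3 * mu.
Proof.
have := component_approx j; rewrite ler_norml => /andP[_ h].
have := component_norm_le j; have /andP[_ t1] := tau01.
have : tau * mu <= 1 * mu by rewrite ler_wpM2r // ltW.
lra.
Qed.

Lemma component_pseudorandom (e : R) (j : 'I_k.+1) : (0 < j)%N -> 0 <= e ->
  variance j (down_ki k j f) <= e * mu ->
  inner k f (F j) <= (reg P k j)%:R * e * mu
     + (tau + 9 * (reg P k j)%:R * (k%:R ^+ 2 * gamma)) * mu.
Proof.
move=> j0 e0 Hv; have jk : (j <= k)%N by rewrite -ltnS.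
have ijk : (0 < j <= k)%N by rewrite j0.
apply: (@coefficient_bound _ _ _ _ _ _ _ (n j ^+ 2)) => //.
- exact: (reg_ge1 Dwd kd).
- by rewrite mulr_ge0 ?exprn_ge0.
- exact: tau01.
- have h1 := inner_H_space_sqr Dwd kd S_neq0 S_rk ijk (Hg j) Hv.
  have h2 := up_ki_H_lower Dwd Pep Pnl k_gt0 kd gamma_small jk (Hg j).
  rewrite -(cnorm_sqr k) -(mulrA 3) in h2.
  set q := _ - _ in h2 *.
  (* A negative [q] makes the left side nonpositive. *)
  have [q0|q0] := lerP 0 q; last first.
    apply: (@le_trans _ _ 0); first by rewrite mulr_le0_ge0 ?sqr_ge0 // ltW.
    by rewrite mulr_ge0 ?sqr_ge0 // mulr_ge0 // ltW.
  have h3 : e * mu * (q * inner j (g j) (g j)) <= e * mu * n j ^+ 2.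
    by rewrite ler_wpM2l ?mulr_ge0 ?(ltW mu0).
  apply: le_trans h3; rewrite [leRHS](_ : _ = q * (e * mu * inner j (g j) (g j))); last by ring.
  by rewrite ler_wpM2l.
- exact: component_approx.
- exact: component_norm_le.
Qed.

End QuadraticForm.


(** * The quadratic form of M at an indicator *)

Section QuadraticFormBound.
Variables (R : realType) (P : measured_poset R).
Variables (delta : nat -> R) (gamma : R) (k : nat).
Variables (alpha : {fsfun seq bool -> R with 0}) (c : nat -> R) (eta : R).
Variables (S : {set P}) (eps : nat -> R).
Local Notation d := (poset_dim P).
Local Notation M := (hd_op P alpha).
Local Notation lambda := (fun j => hd_lambda delta k j alpha).
Local Notation r := (stripped_threshold_rank P delta k alpha c eta).-1.
Hypothesis Dwd : D_well_defined P.
Hypothesis Pep : eposet P delta gamma.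
Hypothesis Pnl : non_lazy P gamma.
Hypothesis kd : (k < d)%N.
Hypothesis walk_alpha : hd_walk P k alpha.
Hypothesis c_ge0 : forall j, (j <= k)%N -> 0 <= c j.
Hypothesis c_approx : forall j, (j <= k)%N -> forall f, V_space P k j f ->
  cnorm k [ffun x => M f x - lambda j * f x] <= c j * cnorm k f.
Hypothesis c_sep : forall j, (j < k)%N -> c j + c j.+1 < lambda j - lambda j.+1.
Hypothesis eta_gt0 : 0 < eta.
Hypothesis eta_lt1 : eta < 1.
Hypothesis S_neq0 : S != set0.
Hypothesis S_rk : forall x, x \in S -> rk x = k.
Hypothesis S_pr : l2_pseudorandom k r eps (indic S).
Hypothesis eps_le1 : forall i, (1 <= i <= r)%N -> lambda i < eta -> eps i <= 1.
Hypothesis k_gt0 : (0 < k)%N.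
Local Notation Rm := ((reg_max P k)%:R : R).
Local Notation w := (hd_weight alpha).
Local Notation h := (hd_height alpha).
Local Notation f := (indic S : {ffun P -> R}).
Local Notation mu := (density S : R).
Local Notation Z :=
  (k%:R ^+ 5 * Rm ^+ 2 * (h + k)%:R * h%:R * w).

Let d_gt0 : (0 < d)%N. Proof. exact: (ltn_trans k_gt0 kd). Qed.
Let g0 : 0 <= gamma. Proof. exact: (gamma_ge0 Dwd Pnl d_gt0). Qed.
Let mu0 : 0 < mu. Proof. exact: (density_gt0 Dwd kd S_neq0 S_rk). Qed.
Let r1 : 1 <= Rm. Proof. exact: (reg_max_ge1 Dwd kd). Qed.
Let k1 : 1 <= k%:R :> R. Proof. exact: (k_ge1 R k_gt0). Qed.
Let w1 : 1 <= w. Proof. exact: (hd_weight_ge1 walk_alpha). Qed.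

(** Height 0 would make all lambda_j equal to 1, against the separation of lambda_0 and lambda_1.
    Hence the factor h (h + k) of the error bound is at least 1. *)
Lemma hd_height_gt0 : (0 < h)%N.
Proof.
rewrite lt0n; apply/eqP => h0.
have l j := hd_lambda_height0 delta walk_alpha j h0.
have := c_sep k_gt0; rewrite !l.
have := c_ge0 (leq0n k); have := c_ge0 k_gt0; lra.
Qed.

Local Notation E := (w * (h * (h + k))%:R).
Local Notation rho := (2 * Rm * E * gamma).
Local Notation tau := (6 * k%:R ^+ 3 * Rm * gamma).
Local Notation B := (tau + 9 * Rm * (k%:R ^+ 2 * gamma) + rho * (4 + Rm) + 2 * w * tau).

Let E_ge_w : w <= E.
Proof.
rewrite ler_peMr ?(le_trans ler01 w1) // ler1n muln_gt0 hd_height_gt0.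
by rewrite addn_gt0 hd_height_gt0.
Qed.

(** Expanded, the left side consists of monomials, each at most Z gamma, with coefficients adding up
    to 41. *)
Lemma error_terms_le : k.+1%:R * rho + k%:R * B <= 64 * Z * gamma.
Proof.
have e1 : Z = k%:R ^+ 5 * Rm ^+ 2 * E by rewrite natrM; ring.
rewrite e1 -[k.+1%:R]natr1; have Ew := E_ge_w; have E1 : 1 <= E by apply: le_trans Ew.
set e := E in Ew E1 *.
have E0 : 0 <= e by lra.
have := k1; have := r1; have := w1; have := g0.
move: e Ew E1 E0 (Rm) (k%:R : R) => e Ew E1 E0 a b G W A K.
have K0 : 0 <= b by lra.
have A0 : 0 <= a by lra.
have W0 : 0 <= w by lra.
have pw m : (m <= 5)%N -> b ^+ m <= b ^+ 5 by move=> ?; apply: ler_weXn2l.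
have aa : a <= a ^+ 2 by rewrite expr2 ler_peMl.
have b5 : 0 <= b ^+ 5 by apply: exprn_ge0.
have a2 : 0 <= a ^+ 2 by apply: exprn_ge0.
have bnd x y z : 0 <= x -> x <= b ^+ 5 -> 0 <= y -> y <= a ^+ 2 -> 0 <= z -> z <= e ->
    x * y * z * gamma <= b ^+ 5 * a ^+ 2 * e * gamma.
  move=> x0 x5 y0 y2 z0 ze; rewrite ler_wpM2r //.
  by rewrite ler_pM ?mulr_ge0 // ler_pM.
have b1 : b <= b ^+ 5 by have := pw 1%N isT; rewrite expr1.
have t1 := bnd b a e K0 b1 A0 aa E0 (lexx _).
have t2 := bnd b (a ^+ 2) e K0 b1 a2 (lexx _) E0 (lexx _).
have t3 := bnd (b ^+ 4) a 1 (exprn_ge0 _ K0) (pw 4%N isT) A0 aa ler01 E1.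
have t4 := bnd (b ^+ 3) a 1 (exprn_ge0 _ K0) (pw 3%N isT) A0 aa ler01 E1.
have t5 := bnd (b ^+ 4) a w (exprn_ge0 _ K0) (pw 4%N isT) A0 aa W0 Ew.
have t6 : a * e * gamma <= b * a * e * gamma.
  by rewrite -!mulrA ler_peMl // !mulr_ge0.
have t7 : 0 <= b ^+ 5 * a ^+ 2 * e * gamma by rewrite !mulr_ge0.
move: t1 t2 t3 t4 t5 t6 t7; lra.
Qed.

(** The left side is the most that the terms other than c gamma can contribute to the claimed lower
    bound. Its parts 1, k R_max and k w R_max are each at most k^2 R_max E, and 64 = 4 * 16 leaves
    room for four such parts. *)
Lemma error_trivial : 16 * k%:R ^+ 3 * Rm * gamma > 1 ->
  1 + k%:R * ((1 + w) * Rm) <= 64 * Z * gamma.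
Proof.
move=> big; have e1 : Z = k%:R ^+ 5 * Rm ^+ 2 * E by rewrite natrM; ring.
rewrite e1; have Ew := E_ge_w.
have := k1; have := r1; have := w1.
have W0 : 0 <= w by apply: le_trans w1.
move=> W A K; have K0 : 0 <= k%:R :> R by [].
have A0 : 0 <= Rm by [].
have K2 : (1 : R) <= k%:R ^+ 2 by apply: exprn_ege1.
rewrite [leRHS](_ : _ = 4 * (k%:R ^+ 2 * Rm * E) * (16 * k%:R ^+ 3 * Rm * gamma)); last by ring.
have p0 : 0 <= k%:R ^+ 2 * Rm * E by rewrite !mulr_ge0 ?exprn_ge0.
apply: (@le_trans _ _ (4 * (k%:R ^+ 2 * Rm * E))); last first.
  by rewrite ler_peMr ?mulr_ge0 // ltW.
have q1 : k%:R * (w * Rm) <= k%:R ^+ 2 * Rm * E.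
  rewrite [leLHS](_ : _ = k%:R * Rm * w); last by ring.
  rewrite ler_pM ?mulr_ge0 // ler_wpM2r // expr2 ler_peMl //.
have q2 : k%:R * Rm <= k%:R * (w * Rm) by rewrite ler_wpM2l // ler_peMl.
have q3 : 1 <= k%:R * Rm by rewrite -[leLHS]mulr1 ler_pM.
lra.
Qed.

Hypothesis gamma_small : 16 * k%:R ^+ 3 * Rm * gamma <= 1.

Section Decomposed.
Variable g : nat -> {ffun P -> R}.
Hypothesis Hg : forall j, H_space j (g j).
Hypothesis f_sum : f = \sum_(0 <= j < k.+1) up_ki k j (g j).
Local Notation F := (fun j => up_ki k j (g j)).
Local Notation a := (fun j => inner k f (F j)).

Let rho_ge0 : 0 <= rho.
Proof. by rewrite !mulr_ge0 // ?(le_trans ler01 w1). Qed.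

Lemma hd_component_le (j : 'I_k.+1) : inner k f (M (F j)) <= lambda j * a j + rho * mu.
Proof.
have jk : (j <= k)%N by rewrite -ltnS.
pose e := M (F j) - scalef (lambda j) (F j).
have -> : M (F j) = e + scalef (lambda j) (F j) by rewrite /e subrK.
rewrite innerDr innerZr addrC lerD2l.
apply: le_trans (ler_norm _) (le_trans (cauchy_schwarz _ _ _) _).
have ne := hd_approx Dwd Pep Pnl d_gt0 kd walk_alpha jk (Hg j).
apply: (@le_trans _ _ (cnorm k f * (E * gamma * cnorm j (g j)))).
  by rewrite ler_wpM2l ?cnorm_ge0.
rewrite [leLHS](_ : _ = E * gamma * (cnorm k f * cnorm j (g j))); last by ring.
rewrite [leRHS](_ : _ = E * gamma * (2 * Rm * mu)); last by ring.
have W0 : 0 <= w by apply: le_trans w1.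
rewrite ler_wpM2l ?mulr_ge0 //.
have m0 := ltW mu0.
(* What remains is |1_S| |g_j| <= 2 R_max mu, from |1_S|^2 = mu and |g_j|^2 <= 2 R_max |f_j|^2 <= 4
   R_max mu. *)
rewrite -(ler_pXn2r (n := 2)) ?nnegrE ?mulr_ge0 ?cnorm_ge0 //.
rewrite !exprMn !cnorm_sqr (inner_indic_self S_rk).
have h1 := up_ki_H_norm Dwd Pep Pnl k_gt0 kd gamma_small jk (Hg j).
have h2 := component_norm_le Dwd Pep Pnl k_gt0 kd gamma_small S_neq0 S_rk Hg f_sum j.
rewrite cnorm_sqr in h2.
have h3 : inner j (g j) (g j) <= 2 * Rm * (2 * mu).
  by apply: le_trans h1 _; rewrite ler_wpM2l ?mulr_ge0.
have h4 : mu * inner j (g j) (g j) <= mu * (2 * Rm * (2 * mu)) by rewrite ler_wpM2l.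
apply: le_trans h4 _.
rewrite [leLHS](_ : _ = 2 ^+ 2 * (Rm * mu ^+ 2)); last by ring.
rewrite -!mulrA ler_wpM2l // ler_wpM2l // ler_peMl //.
by rewrite mulr_ge0 ?exprn_ge0.
Qed.

(** [B] covers four cases. If lambda_j >= eta, pseudorandomness bounds a_j for j <= r, and lambda_j
    - eta is O(gamma) for j > r. If lambda_j < eta, it matters that a_j is nearly nonnegative. *)
Lemma excess_component_le (j : 'I_k.+1) : (0 < j)%N ->
  (lambda j - eta) * a j <=
  mu * (if (j <= r)%N then (lambda j - eta) * (reg P k j)%:R * eps j else 0) + B * mu.
Proof.
move=> j0; have jk : (j <= k)%N by rewrite -ltnS.
have ge := component_ge Dwd Pep Pnl k_gt0 kd gamma_small S_neq0 S_rk Hg f_sum j.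
have le := component_le Dwd Pep Pnl k_gt0 kd gamma_small S_neq0 S_rk Hg f_sum j.
have /andP[t0 t1] := tau01 Dwd Pnl k_gt0 kd gamma_small.
have lam1 : lambda j <= 1.
  have := @interval_sep _ _ _ _ _ c_ge0 c_sep 0 j; rewrite j0 jk => /(_ isT).
  rewrite (hd_lambda0 Pep d_gt0 walk_alpha).
  have := c_ge0 (leq0n k); have := c_ge0 jk; lra.
have lamw : - w <= lambda j.
  by have := hd_lambda_norm Pep d_gt0 kd walk_alpha j; rewrite ler_norml => /andP[].
have W := w1; have m0 := ltW mu0; have rh := rho_ge0.
have et0 := eta_gt0; have et1 := eta_lt1.
have W0 : 0 <= w by lra.
have RmB : 0 <= rho * Rm * mu by rewrite !mulr_ge0.
have s1 : 0 <= tau * mu by rewrite mulr_ge0.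
have s2 : 0 <= 9 * Rm * (k%:R ^+ 2 * gamma) * mu by rewrite !mulr_ge0 ?exprn_ge0.
have s3 : 0 <= rho * mu by rewrite mulr_ge0.
have s4 : 0 <= w * tau * mu by rewrite mulr_ge0 // mulr_ge0.
have tm : tau * mu <= mu by rewrite ler_piMl.
set L := lambda j - eta.
have [jr|jr] := leqP j r.
  have ijr : (0 < j <= r)%N by rewrite j0.
  have rk_ : (r <= k)%N := stripped_le P delta k alpha c eta.
  have e0 := pseudorandom_eps_ge0 Dwd kd S_neq0 S_rk ijr rk_ S_pr.
  have [L0|L0] := lerP 0 L.
    have Hv := S_pr ijr; rewrite -(density_expect S_rk) in Hv.
    have := component_pseudorandom Dwd Pep Pnl k_gt0 kd gamma_small S_neq0 S_rk Hg f_sum j0 e0 Hv.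
    have rj : 9 * (reg P k j)%:R * (k%:R ^+ 2 * gamma) * mu
        <= 9 * Rm * (k%:R ^+ 2 * gamma) * mu.
      rewrite ler_wpM2r // ler_wpM2r ?mulr_ge0 ?exprn_ge0 // ler_wpM2l //.
      exact: reg_le_max.
    set t := (tau + 9 * Rm * (k%:R ^+ 2 * gamma)) * mu.
    move=> ap; have {}ap : a j <= (reg P k j)%:R * eps j * mu + t by rewrite /t; lra.
    have h1 : L * a j <= L * ((reg P k j)%:R * eps j * mu + t) by rewrite ler_wpM2l.
    have t_ge0 : 0 <= t by rewrite /t; lra.
    have h2 : L * t <= t by rewrite ler_piMl // /L; lra.
    have h3 : t = tau * mu + 9 * Rm * (k%:R ^+ 2 * gamma) * mu by rewrite /t; ring.
    move: h1 h2; rewrite h3; lra.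
  (* The pseudorandomness term is now nonpositive; eps_j <= 1 and eta - lambda_j <= rho keep it
     above -rho R_max mu. *)
  have e1 : eps j <= 1 by apply: eps_le1 => //; rewrite -subr_lt0.
  have la := lambda_above Dwd Pep Pnl k_gt0 kd walk_alpha c_ge0 c_approx c_sep gamma_small ijr.
  have L1 : - L <= rho by rewrite /L; lra.
  have h1 : - L * - a j <= - L * (tau * mu) by rewrite ler_wpM2l //; lra.
  have h2 : - L * (tau * mu) <= rho * mu by rewrite ler_pM //; lra.
  have h3 : - L * ((reg P k j)%:R * eps j * mu) <= rho * (Rm * 1 * mu).
    rewrite ler_pM ?mulr_ge0 //; first by lra.
    rewrite ler_wpM2r // ler_pM //.
    exact: reg_le_max.
  lra.
have lb := lambda_below Dwd Pep Pnl k_gt0 kd walk_alpha c_ge0 c_approx c_sep gamma_small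
  (introT andP (conj jr jk)).
rewrite mulr0 add0r.
have [L0|L0] := lerP 0 L.
  have h1 : L * a j <= L * (3 * mu) by rewrite ler_wpM2l.
  have h2 : L * (3 * mu) <= rho * (3 * mu) by rewrite ler_wpM2r ?mulr_ge0 // /L; lra.
  lra.
have h1 : - L * - a j <= - L * (tau * mu) by rewrite ler_wpM2l //; lra.
(* Here eta - lambda_j <= 1 + w <= 2 w. *)
have h2 : - L * (tau * mu) <= 2 * w * (tau * mu) by rewrite ler_wpM2r // /L; lra.
lra.
Qed.

(** As the a_j add up to mu, replacing each lambda_j by lambda_j - eta shifts the sum by exactly eta
    mu; level 0 then gives (1 - eta) mu^2, and the other excesses are bounded one by one. *)
Lemma quadratic_form_decomposed :
  inner k f (M f) <= mu * ((1 - eta) * mu + eta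
    + \sum_(1 <= i < r.+1) (lambda i - eta) * (reg P k i)%:R * eps i
    + 64 * Z * gamma).
Proof.
have m0 := ltW mu0.
pose G i := (lambda i - eta) * (reg P k i)%:R * eps i.
have s1 : inner k f (M f) <= \sum_(j < k.+1) lambda j * a j + k.+1%:R * (rho * mu).
  rewrite {2}f_sum big_mkord raddf_sum inner_sumr /=.
  have -> : k.+1%:R * (rho * mu) = \sum_(j < k.+1) rho * mu.
    by rewrite sumr_const card_ord mulr_natl.
  rewrite -big_split /=; apply: ler_sum => j _; exact: hd_component_le.
have s2 : \sum_(j < k.+1) lambda j * a j
   = eta * mu + \sum_(j < k.+1) (lambda j - eta) * a j.
  rewrite [in RHS](density_components S_rk f_sum) mulr_sumr -big_split /=.
  by apply: eq_bigr => j _; ring.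
have s3 : \sum_(j < k.+1) (lambda j - eta) * a j <=
   (1 - eta) * mu ^+ 2 + (mu * (\sum_(1 <= i < r.+1) G i) + k%:R * (B * mu)).
  rewrite big_ord_recl /= (component0 Dwd kd S_rk Hg f_sum).
  rewrite (hd_lambda0 Pep d_gt0 walk_alpha) lerD2l.
  have -> : \sum_(1 <= i < r.+1) G i = \sum_(i < k) if (i.+1 <= r)%N then G i.+1 else 0.
    rewrite big_add1 /= (big_nat_widen _ _ _ _ _ (stripped_le P delta k alpha c eta)).
    by rewrite big_mkord big_mkcond.
  have -> : k%:R * (B * mu) = \sum_(j < k) B * mu.
    by rewrite sumr_const card_ord mulr_natl.
  rewrite mulr_sumr -big_split /=; apply: ler_sum => j _.
  exact: (@excess_component_le (lift ord0 j)).
have s4 : (k.+1%:R * rho + k%:R * B) * mu <= 64 * Z * gamma * mu.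
  by rewrite ler_wpM2r // error_terms_le.
move: s1 s2 s3 s4; rewrite -/(G _); lra.
Qed.

End Decomposed.

Lemma quadratic_form_le :
  inner k f (M f) <= mu * ((1 - eta) * mu + eta
    + \sum_(1 <= i < r.+1) (lambda i - eta) * (reg P k i)%:R * eps i
    + 64 * Z * gamma).
Proof.
have [g [Hg f_sum]] := level_decomposition Dwd kd (cochain_indic S_rk).
exact: quadratic_form_decomposed f_sum.
Qed.

End QuadraticFormBound.

(** * Degenerate cases and conclusion *)

Lemma max_delta_le1 (R : realType) (P : measured_poset R) delta gamma :
  eposet P delta gamma -> max_delta P delta <= 1.
Proof.
move=> Pep; rewrite /max_delta big_nat_cond.
elim/big_rec: _ => [|i x /andP[/andP[i1 id] _] x1]; first exact: ler01.
rewrite ge_max x1 andbT.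
have /andP[a0 a1] := delta01 Pep id.
have /andP[b0 b1] := delta01 Pep (leq_ltn_trans (leq_pred i) id).
by rewrite mulr_ile1 ?subr_ge0 // lerBlDr lerDl.
Qed.

Lemma density_level0 (R : realType) (P : measured_poset R) (S : {set P}) :
  D_well_defined P -> S != set0 -> (forall x, x \in S -> rk x = 0%N) ->
  density S = 1 :> R.
Proof.
move=> Dwd /set0Pn[x xS] S0; rewrite -(sum_piw Dwd (leq0n _)).
apply: eq_bigl => y; apply/idP/eqP => [/S0 //|ry].
have : x \in [set x : P | rk x == 0%N] by rewrite inE S0.
have : y \in [set x : P | rk x == 0%N] by rewrite inE ry.
have /eqP/cards1P[t ->] := card_rk0 P.
by rewrite !inE => /eqP -> /eqP <-.
Qed.

Theorem theorem6p7 (R : realType) :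
  exists C : R,
  forall (P : measured_poset R) (delta : nat -> R) (gamma : R) (k : nat)
    (alpha : {fsfun seq bool -> R with 0}) (c : nat -> R) (eta : R)
    (S : {set P}) (eps : nat -> R),
  let M := hd_op P alpha in
  let lambda := fun j => hd_lambda delta k j alpha in
  let r := (stripped_threshold_rank P delta k alpha c eta).-1 in
  D_well_defined P ->
  eposet P delta gamma ->
  non_lazy P gamma ->
  (k < poset_dim P)%N ->
  hd_walk P k alpha ->
  monotonic delta k alpha ->
  (forall j, (j <= k)%N -> 0 <= c j) ->
  (forall j, (j <= k)%N -> forall f, V_space P k j f ->
     cnorm k [ffun x => M f x - lambda j * f x] <= c j * cnorm k f) ->
  (forall j, (j < k)%N -> c j + c j.+1 < lambda j - lambda j.+1) ->
  0 < eta ->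
  S != set0 ->
  (forall x, x \in S -> rk x = k) ->
  (l2_pseudorandom k r eps (indic S) \/ linf_pseudorandom k r eps (indic S)) ->
  (forall i, (1 <= i <= r)%N -> lambda i < eta -> eps i <= 1) ->
  exists c' : R,
    (0 < max_delta P delta ->
       c' <= C * (k%:R ^+ 5 * (reg_max P k)%:R ^+ 2
                  * (hd_height alpha + k)%:R * (hd_height alpha)%:R
                  * hd_weight alpha)
             / max_delta P delta) /\
    1 - density S - (1 - density S) * eta
      - \sum_(1 <= i < r.+1) (lambda i - eta) * (reg P k i)%:R * eps i
      - c' * gamma
    <= expansion k M S.
Proof.
exists 64 => P delta gamma k alpha c eta S eps M lambda r.
move=> Dwd Pep Pnl kd walk_alpha mono c_ge0 c_approx c_sep eta0 S_neq0 S_rk S_pr eps_le1.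
have d_gt0 : (0 < poset_dim P)%N := leq_ltn_trans (leq0n k) kd.
have g0 := gamma_ge0 Dwd Pnl d_gt0.
have mu0 := density_gt0 Dwd kd S_neq0 S_rk.
have mu1 := density_le1 Dwd kd S_rk.
have w1 := hd_weight_ge1 walk_alpha.
have Phi0 := expansion_ge0 Dwd kd S_neq0 S_rk walk_alpha.
have rk_ : (r <= k)%N := stripped_le P delta k alpha c eta.
set Z := k%:R ^+ 5 * (reg_max P k)%:R ^+ 2 * (hd_height alpha + k)%:R
  * (hd_height alpha)%:R * hd_weight alpha.
have w0 : 0 <= hd_weight alpha by apply: le_trans w1.
have Z0 : 0 <= Z by rewrite !mulr_ge0 ?exprn_ge0.
exists (64 * Z); split.
  move=> md0; rewrite ler_pdivlMr // ler_piMr ?(mulr_ge0 _ Z0) //.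
  exact: (max_delta_le1 Pep).
have Zg : 0 <= 64 * Z * gamma by rewrite mulr_ge0 // mulr_ge0.
(* At k = 0 the set S is all of X(0), so its density is 1 and the lower bound is at most 0. *)
case: (posnP k) => [k0|k_gt0].
  have r0 : r = 0%N by apply/eqP; rewrite -leqn0 -k0.
  rewrite r0 big_geq // (density_level0 Dwd S_neq0); last by move=> x /S_rk ->.
  move: Phi0; rewrite -/M; lra.
(* For eta >= 1 the sum is empty and 1 - eta <= 0, so again the lower bound is at most 0. *)
have [eta1|eta1] := lerP 1 eta.
  have r0 : r = 0%N := stripped_eta_ge1 Pep k_gt0 kd walk_alpha c_ge0 c_sep eta1.
  rewrite r0 big_geq //.
  have : (1 - density S) * (1 - eta) <= 0 by rewrite mulr_ge0_le0 ?subr_ge0 ?subr_le0.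
  move: Phi0; rewrite -/M; lra.
have S_l2 : l2_pseudorandom k r eps (indic S).
  by case: S_pr => // /(l2_of_linf Dwd kd S_rk rk_).
have [small|big] := lerP (16 * k%:R ^+ 3 * (reg_max P k)%:R * gamma) 1.
  have := quadratic_form_le Dwd Pep Pnl kd walk_alpha c_ge0 c_approx c_sep eta0 eta1
    S_neq0 S_rk S_l2 eps_le1 k_gt0 small.
  rewrite (expansionE Dwd kd S_neq0 S_rk walk_alpha) -ler_pdivrMl // mulrC.
  rewrite -/M -/Z; lra.
have bnd := error_trivial Dwd kd walk_alpha c_ge0 c_sep k_gt0 big.
rewrite -/Z in bnd.
(* A term with lambda_i >= eta only lowers the bound; otherwise eta - lambda_i <= 1 + w and eps_i <=
   1. *)
have term i : (1 <= i < r.+1)%N ->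
  - ((lambda i - eta) * (reg P k i)%:R * eps i) <= (1 + hd_weight alpha) * (reg_max P k)%:R.
  move=> ir; have e0 := pseudorandom_eps_ge0 Dwd kd S_neq0 S_rk ir rk_ S_l2.
  have ik : (i <= k)%N by case/andP: ir => _ ir; apply: leq_trans rk_.
  have rm : 0 <= (1 + hd_weight alpha) * (reg_max P k)%:R :> R.
    by rewrite mulr_ge0 // addr_ge0 // (le_trans ler01).
  have [le|lt] := lerP eta (lambda i).
    by apply: le_trans rm; rewrite oppr_le0 !mulr_ge0 // subr_ge0.
  have e1 := eps_le1 i ir lt.
  have := hd_lambda_norm Pep d_gt0 kd walk_alpha i; rewrite ler_norml => /andP[lw _].
  rewrite -!mulNr -[leRHS]mulr1 ler_pM ?mulr_ge0 //; first by move: lt; rewrite /lambda; lra.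
  rewrite ler_pM //; first by move: lt; lra.
    by move: lw; rewrite /lambda; lra.
  exact: reg_le_max.
have sum_le : - \sum_(1 <= i < r.+1) (lambda i - eta) * (reg P k i)%:R * eps i
   <= k%:R * ((1 + hd_weight alpha) * (reg_max P k)%:R).
  rewrite -sumrN; apply: (@le_trans _ _ (\sum_(1 <= i < r.+1)
    ((1 + hd_weight alpha) * (reg_max P k)%:R))).
    by apply: ler_sum_nat.
  rewrite sumr_const_nat subSS subn0 -[leLHS]mulr_natl ler_wpM2r ?ler_nat //.
  by rewrite mulr_ge0 // addr_ge0 // (le_trans ler01).
have m1 : (1 - density S) * (1 - eta) <= 1.
  by rewrite mulr_ile1 ?subr_ge0 // ?(ltW eta1) // lerBlDr lerDl ltW.
move: Phi0; rewrite -/M; lra.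
Qed.
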